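(* Let $\mathbf k$ be a field of characteristic $0$, let $V$ be a finite dimensional graded $\mathbf k$-vector space, and let $(\mathrm{End}(V),m_2=\cdot)$ be the endomorphism graded algebra of $V$ with composition as multiplication. The map $$\chi:\ \big(r_1=s_1=d_V,\{r_n\}_{n\ge2},\{s_n\}_{n\ge2}\big)\longmapsto\big(m_1=-[d_V,-],\ \{\mathscr F(r_n)\}_{n\ge2},\ \{\mathscr F(s_n)\}_{n\geq2}\big)$$ is a bijection between the set of associative infinity-Yang-Baxter pairs in the graded algebra $(\mathrm{End}(V),m_2)$ and the set of triples $(m_1,\{R_n\}_{n\ge1},\{S_n\}_{n\ge1})$ in which $m_1$ is a differential on the graded algebra $(\mathrm{End}(V),m_2)$ and $(\{R_n\}_{n\ge1},\{S_n\}_{n\ge1})$ is a homotopy coupled Rota-Baxter operator on the dg algebra $(\mathrm{End}(V),m_1,m_2)$; here $R_n=\mathscr F(r_{n+1})$ and $S_n=\mathscr F(s_{n+1})$ for $n\ge1$.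
   Context: Gradings are homological and the Koszul sign rule is used throughout (including for the product of $A^{\otimes n}$). $\mathrm{End}(V)=\mathrm{Hom}(V,V)$ is graded by degree of maps. A differential on a graded algebra is a degree $-1$ graded derivation of square zero. $[d,x]=d\cdot x-(-1)^{|d||x|}x\cdot d$ is the graded commutator, so for $|d|=-1$, $-[d,x]=-d\cdot x+(-1)^{|x|}x\cdot d$. **The map $\mathscr F$.** For a graded algebra $A$ and $n\ge1$, $\mathscr F:A^{\otimes n+1}\to\mathrm{Hom}(A^{\otimes n},A)$ is $$\mathscr F(a_1\otimes\cdots\otimes a_{n+1})(x_1,\dots,x_n)=(-1)^{\sum_{k=1}^n\sum_{j=k+1}^{n+1}|x_k||a_j|}\,a_1\cdot x_1\cdot a_2\cdots a_n\cdot x_n\cdot a_{n+1}.$$ **Associative infinity-Yang-Baxter pairs.** Let $A$ be a unitary graded algebra. An associative infinity-Yang-Baxter pair consists of families $(\{r_n\}_{n\ge1},\{s_n\}_{n\ge1})$, $r_n,s_n\in A^{\otimes n}$ homogeneous with $|r_n|=|s_n|=n-2$ and $r_1=s_1=:d$, such that $d\cdot d=0$ and, for all $n\ge1$, in $A^{\otimes n+1}$: $$\sum_{\substack{i+j=n\\ i,j\ge1}}(-1)^{1+i}r_{i+1}^{1,\dots,i+1}\cdot r_{j+1}^{i+1,\dots,n+1}=\sum_{k=1}^{n+1}\big(d^{\,k}\cdot r_{n+1}+(-1)^nr_{n+1}\cdot d^{\,k}\big)$$ $$+\sum_{\substack{i+j=n\\ i,j\ge1}}\sum_{s=1}^{i}(-1)^{s-1+(j-1)(n-s-j-1)}\Big(r_{i+1}^{1,\dots,s,s+j+1,\dots,n+1}\cdot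 r_{j+1}^{s,\dots,s+j}+(-1)^{(1-j)i}s_{j+1}^{s+1,\dots,s+j+1}\cdot r_{i+1}^{1,\dots,s,s+j+1,\dots,n+1}\Big),$$ and $$\sum_{\substack{i+j=n\\ i,j\ge1}}(-1)^{1+i}s_{i+1}^{1,\dots,i+1}\cdot s_{j+1}^{i+1,\dots,n+1}=\sum_{k=1}^{n+1}\big(d^{\,k}\cdot s_{n+1}+(-1)^ns_{n+1}\cdot d^{\,k}\big)$$ $$+\sum_{\substack{i+j=n\\ i,j\ge1}}\sum_{s=1}^{i}(-1)^{s-1+(j-1)(n-s-j-1)}\Big(s_{i+1}^{1,\dots,s,s+j+1,\dots,n+1}\cdot r_{j+1}^{s,\dots,s+j}+(-1)^{(1-j)i}s_{j+1}^{s+1,\dots,s+j+1}\cdot s_{i+1}^{1,\dots,s,s+j+1,\dots,n+1}\Big).$$ Here, for $t\in A^{\otimes m}$ and $1\le c_1<\dots<c_m\le n+1$, $t^{c_1,\dots,c_m}\in A^{\otimes n+1}$ is obtained by placing the successive tensor factors of $t$ in positions $c_1,\dots,c_m$ and the unit $1$ in all other positions; $d^{\,k}$ is $d$ in position $k$. **Homotopy coupled Rota-Baxter operators on a dg algebra.** Let $(A,m_1,m_2)$ be a dg algebra ($m_1$ the differential, $m_2$ the product). A homotopy coupled Rota-Baxter operator on it is a pair of families of graded maps $R_n,S_n:A^{\otimes n}\to A$, $n\ge1$, of degree $n-1$, such that for all $n\ge1$ $$m_1\circ R_n+\sum_{\substack{i+j=n\\ i,j\ge1}}(-1)^{i+1}m_2\circ(R_i\otimes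 R_j)=(-1)^{n-1}\sum_{i=0}^{n-1}R_n\circ(\mathrm{id}^{\otimes i}\otimes m_1\otimes\mathrm{id}^{\otimes n-i-1})$$ $$+\sum_{\substack{p+q=n\\ p,q\ge1}}\sum_{i=0}^{p-1}\Big((-1)^{i+(q-1)(p-i)}R_p\circ\big(\mathrm{id}^{\otimes i}\otimes m_2\circ(R_q\otimes\mathrm{id})\otimes\mathrm{id}^{\otimes p-i-1}\big)+(-1)^{i+(q-1)(p-i-1)}R_p\circ\big(\mathrm{id}^{\otimes i}\otimes m_2\circ(\mathrm{id}\otimes S_q)\otimes\mathrm{id}^{\otimes p-i-1}\big)\Big),$$ and the same equation holds with $m_1\circ S_n$, $m_2\circ(S_i\otimes S_j)$, $S_n$ and the outer $S_p$ in place of $m_1\circ R_n$, $m_2\circ(R_i\otimes R_j)$, $R_n$ and the outer $R_p$ (the inner $R_q$ and $S_q$ being unchanged). *)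

(* Defs.v *)
From HB Require Import structures.
From mathcomp Require Import all_boot all_order all_algebra.
From mathcomp Require Import boolp classical_sets functions.

Set Implicit Arguments.
Unset Strict Implicit.
Unset Printing Implicit Defensive.

Import Order.TTheory GRing.Theory Num.Theory.

Local Open Scope ring_scope.

(* Koszul signs are written with integer exponents, [(-1) ^ z] for [z : int],
   since degrees (and some exponents of the equations) may be negative. *)

Definition ksgn (k : fieldType) (z : int) : k := (-1) ^ z.
Arguments ksgn {k} z.

(** * Finite dimensional graded vector spaces *)

Definition is_grading (k : fieldType) (V : vectType k)
    (G : int -> {vspace V}) : Prop :=
  exists s : seq int,
    [/\ uniq s, (forall p, p \notin s -> G p = 0%VS),
        (\sum_(p <- s) G p)%VS = fullv & directv (\sum_(p <- s) G p)].

Record gradedVect (k : fieldType) := GradedVect {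
  gv_sort :> vectType k;
  gpiece : int -> {vspace gv_sort};
  gpieceP : is_grading gpiece
}.
Arguments gpiece {k} g p.

Section GradingTheory.
Variables (k : fieldType) (V : vectType k) (G : int -> {vspace V}).

Lemma directv_seqP (s : seq int) : uniq s ->
  reflect (forall u : int -> V, (forall p, p \in s -> u p \in G p) ->
             \sum_(p <- s) u p = 0 -> forall p, p \in s -> u p = 0)
          (directv (\sum_(p <- s) G p)).
Proof.
move=> us.
have -> : directv (\sum_(p <- s) G p)
        = directv (\sum_(i < size s) G (tnth (in_tuple s) i)).
  by rewrite !directvE /= !(big_tnth _ _ s).
apply: (iffP (directv_sum_independent (P := xpredT)
  (Us := fun i => G (tnth (in_tuple s) i)))) => [ind u uG u0 p ps|ind u uG u0 i _].
  have ip : (index p s < size s)%N by rewrite index_mem.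
  have := ind (fun i => u (tnth (in_tuple s) i)) _ _ (Ordinal ip) isT.
  rewrite (tnth_nth 0) /= nth_index //; apply=> [i _|].
    by apply: uG; rewrite mem_tnth.
  by rewrite -[RHS]u0 [RHS]big_tnth.
pose v p : V := \sum_(j < size s | tnth (in_tuple s) j == p) u j.
have vE j : v (tnth (in_tuple s) j) = u j.
  rewrite /v (big_pred1 j) // => l /=.
  by rewrite !(tnth_nth 0) /= nth_uniq.
rewrite -vE; apply: ind; last exact: mem_tnth.
  move=> p ps; have /tnthP[j ->] : p \in in_tuple s by [].
  by rewrite vE; apply: uG.
by rewrite -[RHS]u0 big_tnth; apply: eq_bigr => j _; rewrite vE.
Qed.

Hypothesis grG : is_grading G.

Lemma grading_indep (s : seq int) (u : int -> V) : uniq s ->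
  (forall p, p \in s -> u p \in G p) -> \sum_(p <- s) u p = 0 ->
  forall p, p \in s -> u p = 0.
Proof.
case: grG => t [ut t0 _ /(directv_seqP ut) ind] us uG u0 p ps.
have z q : q \in s -> q \notin t -> u q = 0.
  by move=> qs /t0 Gq; apply/eqP; rewrite -memv0 -Gq uG.
have [pt|/(z _ ps)//] := boolP (p \in t).
have := ind (fun q => if q \in s then u q else 0) _ _ p pt.
rewrite ps; apply => [q _|]; first by case: ifP => [/uG//|_]; rewrite mem0v.
rewrite -big_mkcond -big_filter -[RHS]u0.
rewrite [RHS](bigID (mem t)) /= [X in _ + X]big_seq_cond.
rewrite [X in _ + X]big1 ?addr0; last first.
  by move=> q /andP[qs qt]; apply: z.
rewrite -[RHS]big_filter; apply: perm_big; apply: uniq_perm.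
- exact: filter_uniq.
- exact: filter_uniq.
- by move=> q; rewrite !mem_filter andbC.
Qed.

Lemma hbasis_ex :
  exists b : (\dim {:V}).-tuple V, exists d : 'I_(\dim {:V}) -> int,
    basis_of fullv b /\ forall i : 'I_(\dim {:V}), b`_i \in G (d i).
Proof.
case: grG => s [us _ sf ds].
set bs := \big[cat/[::]]_(p <- s) [seq (x : V, p) | x <- vbasis (G p)].
have fstE : [seq xp.1 | xp <- bs] = \big[cat/[::]]_(p <- s) (vbasis (G p) : seq V).
  rewrite /bs (big_morph (map fst) (@map_cat _ _ _) (erefl _)).
  by apply: eq_bigr => p _; rewrite -map_comp map_id.
have bb : basis_of fullv [seq xp.1 | xp <- bs].
  rewrite fstE -sf !(big_tnth _ _ s); apply: bigcat_basis.
    by move: ds; rewrite !directvE /= !(big_tnth _ _ s).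
  by move=> i _; apply: vbasisP.
have sz : size [seq xp.1 | xp <- bs] == \dim {:V}.
  by case/andP: bb => /eqP <- /eqP->.
exists (Tuple sz), (fun i => (nth (0, 0) bs i).2); split=> // i /=.
have ib : (i < size bs)%N by rewrite -(size_map fst) (eqP sz).
rewrite (nth_map (0, 0)) //.
have : {in bs, forall xp, xp.1 \in G xp.2}.
  rewrite /bs; elim: (s) => [|p t IH] xp; first by rewrite big_nil.
  rewrite big_cons mem_cat => /orP[/mapP[x xp' ->]|/IH//].
  exact: vbasis_mem.
by apply; apply: mem_nth.
Qed.

End GradingTheory.

(* A homogeneous basis, with the degrees of its members.  It is only used to
   extend linearly what is prescribed on homogeneous elements: nothing below
   depends on which basis is chosen (see [hlift_tens]). *)
Definition gdim (k : fieldType) (V : gradedVect k) : nat := \dim {:V}.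

Definition hbasis (k : fieldType) (V : gradedVect k) : (gdim V).-tuple V :=
  sval (cid (hbasis_ex (gpieceP V))).

Definition hdeg (k : fieldType) (V : gradedVect k) : 'I_(gdim V) -> int :=
  sval (cid (svalP (cid (hbasis_ex (gpieceP V))))).

Lemma hbasisP (k : fieldType) (V : gradedVect k) : basis_of fullv (hbasis V).
Proof. by case: (svalP (cid (hbasis_ex (gpieceP V)))) => d []. Qed.

Lemma hbasis_homog (k : fieldType) (V : gradedVect k) (i : 'I_(gdim V)) :
  (hbasis V)`_i \in gpiece V (hdeg i).
Proof. by case: (svalP (cid (svalP (cid (hbasis_ex (gpieceP V)))))). Qed.

(** * Graded algebras *)

Record gradedAlg (k : fieldType) := GradedAlg {
  ga_vect :> gradedVect k;
  gmul : ga_vect -> ga_vect -> ga_vect;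
  gone : ga_vect;
  gmul_linearr : forall x, linear (gmul x);
  gmul_linearl : forall y, linear (gmul^~ y);
  gmulA : associative gmul;
  gmul1x : left_id gone gmul;
  gmulx1 : right_id gone gmul;
  gone_deg : gone \in gpiece ga_vect 0;
  gmul_deg : forall p q x y, x \in gpiece ga_vect p -> y \in gpiece ga_vect q ->
    gmul x y \in gpiece ga_vect (p + q)
}.
Arguments gmul {k g}.
Arguments gone {k g}.

(** * The endomorphism graded algebra *)

Section EndAlg.
Variables (k : fieldType) (V : gradedVect k).

Definition evalv (v : V) (f : 'End(V)) : V := f v.
Fact evalv_is_linear v : linear (evalv v).
Proof. by move=> a f g; rewrite /evalv !lfun_simp. Qed.
HB.instance Definition _ v :=
  GRing.isLinear.Build k 'End(V) V _ (evalv v) (evalv_is_linear v).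

(* The maps of degree [p], tested on a homogeneous basis; see [mem_endpiece]. *)
Definition endpiece (p : int) : {vspace 'End(V)} :=
  (\bigcap_(i < gdim V)
     (linfun (evalv (hbasis V)`_i) @^-1: gpiece V (hdeg i + p)))%VS.

Lemma mem_endpiece_basis (p : int) (f : 'End(V)) :
  reflect (forall i : 'I_(gdim V), f (hbasis V)`_i \in gpiece V (hdeg i + p))
          (f \in endpiece p).
Proof.
rewrite memvE; apply: (iffP subv_bigcapP) => [h i|h i _].
  by have := h i isT; rewrite -memvE -memv_preim lfunE.
by rewrite -memvE -memv_preim lfunE; apply: h.
Qed.

End EndAlg.

Section CoordDeg.
Variables (k : fieldType) (V : gradedVect k).

Lemma coord_hbasis (v : V) : v = \sum_i coord (hbasis V) i v *: (hbasis V)`_i.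
Proof. by apply: coord_basis; [apply: hbasisP | rewrite memvf]. Qed.

Lemma coord_deg (v : V) (p : int) (i : 'I_(gdim V)) :
  v \in gpiece V p -> coord (hbasis V) i v != 0 -> hdeg i = p.
Proof.
move=> vp; apply: contraNeq => ip.
pose w q := \sum_(j | hdeg j == q) coord (hbasis V) j v *: (hbasis V)`_j
            - (if q == p then v else 0).
have wq q : w q \in gpiece V q.
  rewrite /w memvB //; last by case: eqP => [->|_]; rewrite ?mem0v.
  by apply: memv_suml => j /eqP <-; rewrite memvZ ?hbasis_homog.
pose s := undup (p :: codom (@hdeg k V)).
have us : uniq s := undup_uniq _.
have ps : p \in s by rewrite mem_undup inE eqxx.
have js j : @hdeg k V j \in s.
  by rewrite mem_undup in_cons orbC (codom_f (@hdeg k V) j).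
have pick1 r (F : int -> V) : r \in s -> \sum_(q <- s | r == q) F q = F r.
  move=> rs; under eq_bigl do rewrite eq_sym.
  rewrite -big_filter.
  by rewrite (filter_pred1_uniq us rs : [seq q <- s | q == r] = _) big_seq1.
have w0 : \sum_(q <- s) w q = 0.
  rewrite /w sumrB -[X in _ - X]big_mkcond /=.
  under [X in _ - X]eq_bigl do rewrite eq_sym.
  rewrite pick1 // (exchange_big_dep xpredT) //= [X in X - _](_ : _ = v) ?subrr //.
  by rewrite [RHS]coord_hbasis; apply: eq_bigr => j _; rewrite pick1.
have wi : w (hdeg i) = 0 by apply: (grading_indep (gpieceP V) us _ w0).
move: wi; rewrite /w (negPf ip) subr0 => /(congr1 (coord (hbasis V) i)).
have fr : free (hbasis V) := basis_free (hbasisP V).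
rewrite linear_sum linear0 (bigD1 i) //= linearZ /= coord_free // eqxx mulr1.
rewrite big1 ?addr0 => [->//|j /andP[_ ji]].
by rewrite linearZ /= coord_free // eq_sym -val_eqE in ji *; rewrite (negPf ji) mulr0.
Qed.

Lemma mem_endpiece (p : int) (f : 'End(V)) :
  reflect (forall q, (f @: gpiece V q <= gpiece V (q + p))%VS)
          (f \in endpiece V p).
Proof.
apply: (iffP (mem_endpiece_basis _ _)) => [h q|h i]; last first.
  by apply: (subvP (h (hdeg i))); rewrite memv_img ?hbasis_homog.
apply/subvP=> _ /memv_imgP[v vq ->].
rewrite [v]coord_hbasis linear_sum; apply: memv_suml => i _ /=.
rewrite linearZ /=; have [->|/(coord_deg vq) <-] := eqVneq (coord (hbasis V) i v) 0.
  by rewrite scale0r mem0v.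
by rewrite memvZ ?h.
Qed.

End CoordDeg.

Section EndGrading.
Variables (k : fieldType) (V : gradedVect k).

Lemma lfun_hbasisP (f g : 'End(V)) :
  (forall i : 'I_(gdim V), f (hbasis V)`_i = g (hbasis V)`_i) -> f = g.
Proof.
move=> fg; apply/lfunP => v; rewrite [v]coord_hbasis !linear_sum.
by apply: eq_bigr => i _; rewrite !linearZ /= fg.
Qed.

(* The map sending the [j]-th basis vector to [v] and the other ones to 0. *)
Let rk1 (j : 'I_(gdim V)) (v : V) : 'End(V) :=
  linfun (fun w => coord (hbasis V) j w *: v).

Let rk1E j v w : rk1 j v w = coord (hbasis V) j w *: v.
Proof.
pose f w := coord (hbasis V) j w *: v.
have fl : linear f by move=> a x y; rewrite /f linearP scalerDl scalerA.
pose fL : {linear V -> V} := HB.pack f (GRing.isLinear.Build k V V _ f fl).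
exact: (lfunE fL).
Qed.

Let coordE (i j : 'I_(gdim V)) : coord (hbasis V) j (hbasis V)`_i = (i == j)%:R.
Proof. by rewrite coord_free //; apply: basis_free (hbasisP V). Qed.

Lemma endpiece_grading : is_grading (@endpiece k V).
Proof.
pose S : seq int := undup [seq hdeg ij.1 - hdeg ij.2 | ij : 'I_(gdim V) * 'I_(gdim V)].
have inS (i j : 'I_(gdim V)) : hdeg i - hdeg j \in S.
  by rewrite mem_undup; apply/mapP; exists (i, j); rewrite ?mem_enum.
have uS : uniq S := undup_uniq _.
exists S; split=> // [p pS||].
- apply/eqP; rewrite -subv0; apply/subvP => f /mem_endpiece_basis fp.
  rewrite memv0; apply/eqP/lfun_hbasisP => j; rewrite zero_lfunE.
  rewrite [LHS]coord_hbasis big1 // => i _.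
  have [->|/(coord_deg (fp j)) ij] := eqVneq (coord (hbasis V) i (f (hbasis V)`_j)) 0.
    by rewrite scale0r.
  by move: pS; rewrite -[p](addKr (hdeg j)) addrC -ij inS.
- apply/eqP; rewrite eqEsubv subvf /=; apply/subvP => f _.
  have -> : f = \sum_(j < gdim V) \sum_(i < gdim V) coord (hbasis V) i (f (hbasis V)`_j)
                                *: rk1 j (hbasis V)`_i.
    apply: lfun_hbasisP => l; rewrite sum_lfunE (bigD1 l) //= [X in _ + X]big1 => [|j jl].
      rewrite addr0 sum_lfunE [LHS]coord_hbasis; apply: eq_bigr => i _.
      by rewrite scale_lfunE rk1E coordE eqxx scale1r.
    rewrite sum_lfunE big1 // => i _.
    by rewrite scale_lfunE rk1E coordE eq_sym (negPf jl) scale0r scaler0.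
  apply: memv_suml => j _; apply: memv_suml => i _; apply: memvZ.
  apply: (subvP (_ : endpiece V (hdeg i - hdeg j) <= _)%VS).
    by rewrite (big_rem _ (inS i j)) /= addvSl.
  apply/mem_endpiece_basis => l; rewrite rk1E coordE.
  case: eqP => [->|_]; last by rewrite scale0r mem0v.
  by rewrite scale1r addrC subrK hbasis_homog.
apply/(directv_seqP _ uS) => u uS' u0 p pS; apply: lfun_hbasisP => j.
rewrite zero_lfunE.
pose w q := u (q - hdeg j) (hbasis V)`_j.
have := grading_indep (gpieceP V) (s := [seq q + hdeg j | q <- S]) (u := w).
move=> /(_ _ _ _ (p + hdeg j)); rewrite /w addrK; apply.
- by rewrite map_inj_uniq //; apply: addIr.
- move=> _ /mapP[q qS ->]; rewrite addrK addrC.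
  by apply/mem_endpiece_basis; apply: uS'.
- rewrite big_map; under eq_bigr do rewrite addrK.
  by rewrite -sum_lfunE u0 zero_lfunE.
- exact: (map_f (fun q => q + hdeg j)) pS.
Qed.

Definition endVect : gradedVect k := GradedVect endpiece_grading.

Definition endmul (f g : endVect) : endVect := (f \o g)%VF.

Fact endmul_linearr f : linear (endmul f).
Proof. by move=> a g h; rewrite /endmul comp_lfunDr -comp_lfunZr. Qed.
Fact endmul_linearl g : linear (endmul^~ g).
Proof. by move=> a f h; rewrite /endmul comp_lfunDl -comp_lfunZl. Qed.
Fact endmulA : associative endmul.
Proof. by move=> f g h; apply: comp_lfunA. Qed.
Fact endmul1x : left_id (\1%VF : endVect) endmul.
Proof. by move=> f; apply: comp_lfun1l. Qed.
Fact endmulx1 : right_id (\1%VF : endVect) endmul.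
Proof. by move=> f; apply: comp_lfun1r. Qed.
Fact endone_deg : (\1%VF : endVect) \in gpiece endVect 0.
Proof. by apply/mem_endpiece_basis => i; rewrite id_lfunE addr0 hbasis_homog. Qed.
Fact endmul_deg p q (f g : endVect) :
  f \in gpiece endVect p -> g \in gpiece endVect q ->
  endmul f g \in gpiece endVect (p + q).
Proof.
move=> /mem_endpiece fp /mem_endpiece gq; apply/mem_endpiece => r.
rewrite limg_comp (subv_trans (limgS _ (gq r))) //.
by rewrite (addrC p) addrA; apply: fp.
Qed.

Definition endAlg : gradedAlg k :=
  GradedAlg endmul_linearr endmul_linearl endmulA endmul1x endmulx1
            endone_deg endmul_deg.

End EndGrading.

(** * Tensor powers *)

(* [tensor V n] is the [n]-th tensor power of [V], in coordinates with respect
   to the basis of pure tensors of members of [hbasis V].  Lists of arguments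
   [x_1, ..., x_n] are functions [x : nat -> V] of which only the values
   [x 0, ..., x n.-1] matter, so [x l] is the argument of index [l + 1]. *)

Section Tensor.
Variables (k : fieldType) (V : gradedVect k).

Definition tensor (n : nat) : vectType k :=
  {ffun {ffun 'I_n -> 'I_(gdim V)} -> k^o}.

Definition tens (n : nat) (x : nat -> V) : tensor n :=
  [ffun phi : {ffun 'I_n -> 'I_(gdim V)} =>
     \prod_(i < n) coord (hbasis V) (phi i) (x i)].

Definition homog (n : nat) (x : nat -> V) (e : nat -> int) : Prop :=
  forall l, (l < n)%N -> x l \in gpiece V (e l).

Definition bvec n (phi : {ffun 'I_n -> 'I_(gdim V)}) (l : nat) : V :=
  if insub l is Some i then (hbasis V)`_(phi i) else 0.

Definition bdeg n (phi : {ffun 'I_n -> 'I_(gdim V)}) (l : nat) : int :=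
  if insub l is Some i then hdeg (phi i) else 0.

(* The elements of degree [p] of the tensor power. *)
Definition tpiece (n : nat) (p : int) : {vspace tensor n} :=
  <<[seq tens n (bvec phi) | phi in
       [pred phi : {ffun 'I_n -> 'I_(gdim V)} | (\sum_(i < n) hdeg (phi i))%R == p]]>>%VS.

(* The linear map on [tensor n] sending [x_1 (x) ... (x) x_n], with [x_l]
   homogeneous of degree [e_l], to [f x e]; see [hlift_tens]. *)
Definition hlift (W : lmodType k) n (f : (nat -> V) -> (nat -> int) -> W)
    (t : tensor n) : W :=
  \sum_phi (t phi : k) *: f (bvec phi) (bdeg phi).

End Tensor.

Section TensorTheory.
Variables (k : fieldType) (V : gradedVect k).

Definition upd (x : nat -> V) (l : nat) (v : V) : nat -> V :=
  fun m => if m == l then v else x m.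

Definition multilin (W : lmodType k) (n : nat) (f : (nat -> V) -> W) : Prop :=
  (forall x y, (forall l, (l < n)%N -> x l = y l) -> f x = f y) /\
  (forall x l, (l < n)%N -> linear (fun v => f (upd x l v))).

Lemma hlift_is_linear (W : lmodType k) n (f : (nat -> V) -> (nat -> int) -> W) :
  linear (@hlift k V W n f).
Proof.
move=> a s t; rewrite /hlift scaler_sumr -big_split /=.
by apply: eq_bigr => phi _; rewrite !ffunE scalerDl scalerA.
Qed.
HB.instance Definition _ (W : lmodType k) n f :=
  GRing.isLinear.Build k (tensor V n) W _ (@hlift k V W n f)
    (@hlift_is_linear W n f).

Lemma bvecE n (phi : {ffun 'I_n -> 'I_(gdim V)}) (i : 'I_n) :
  bvec phi i = (hbasis V)`_(phi i).
Proof. by rewrite /bvec valK. Qed.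

Lemma bdegE n (phi : {ffun 'I_n -> 'I_(gdim V)}) (i : 'I_n) :
  bdeg phi i = hdeg (phi i).
Proof. by rewrite /bdeg valK. Qed.

Lemma homog_bvec n (phi : {ffun 'I_n -> 'I_(gdim V)}) :
  homog n (bvec phi) (bdeg phi).
Proof.
by move=> l ln; rewrite (bvecE phi (Ordinal ln)) (bdegE phi (Ordinal ln)) hbasis_homog.
Qed.

Lemma multilin_sum (W : lmodType k) n (f : (nat -> V) -> W) x :
  multilin n f ->
  f x = \sum_(phi : {ffun 'I_n -> 'I_(gdim V)})
           (\prod_(i < n) coord (hbasis V) (phi i) (x i)) *: f (bvec phi).
Proof.
case=> fext flin.
suff H m : (m <= n)%N -> f x = \sum_(phi : {ffun 'I_m -> 'I_(gdim V)})
    (\prod_(i < m) coord (hbasis V) (phi i) (x i)) *: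
    f (fun l => if (l < m)%N then bvec phi l else x l).
  rewrite (H n (leqnn _)); apply: eq_bigr => phi _; congr (_ *: _).
  by apply: fext => l ->.
elim: m => [_|m IH mn].
  rewrite (big_pred1 [ffun i : 'I_0 => match i with Ordinal _ h =>
      False_rect _ (notF h) end]) => [|phi].
    by rewrite big_ord0 scale1r.
  by rewrite /=; apply/esym/eqP/ffunP => -[].
rewrite IH 1?ltnW //.
pose ext (p : {ffun 'I_m -> 'I_(gdim V)} * 'I_(gdim V)) :
    {ffun 'I_m.+1 -> 'I_(gdim V)} :=
    [ffun i : 'I_m.+1 => if unlift ord_max i is Some i' then p.1 i' else p.2].
pose res (phi : {ffun 'I_m.+1 -> 'I_(gdim V)}) :
    {ffun 'I_m -> 'I_(gdim V)} * 'I_(gdim V) :=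
    ([ffun i : 'I_m => phi (lift ord_max i)], phi ord_max).
have extK : cancel ext res.
  case=> phi j; rewrite /ext /res; congr (_, _); last by rewrite ffunE unlift_none.
  by apply/ffunP => i; rewrite !ffunE liftK.
have resK : cancel res ext.
  move=> phi; apply/ffunP => i; rewrite !ffunE.
  by case: unliftP => [i'|] -> //=; rewrite ffunE.
rewrite (reindex ext) /=; last by exists res => ? _; rewrite ?extK ?resK.
rewrite -(pair_bigA _ (fun phi j =>
  (\prod_(i < m.+1) coord (hbasis V) (ext (phi, j) i) (x i)) *:
    f (fun l => if (l < m.+1)%N then bvec (ext (phi, j)) l else x l))) /=.
apply: eq_bigr => phi _.
pose y l := if (l < m)%N then bvec phi l else x l.
pose fL : {linear V -> W} :=
  HB.pack (fun v => f (upd y m v)) (GRing.isLinear.Build k V W _ _ (flin y m mn)).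
have -> : f y = fL (x m).
  by apply: fext => l _; rewrite /upd; case: eqP => // ->; rewrite /y ltnn.
rewrite [x m]coord_hbasis linear_sum scaler_sumr; apply: eq_bigr => j _.
rewrite linearZ scalerA big_ord_recr /=; congr (_ * _ *: _).
- apply: eq_bigr => i _; rewrite ffunE.
  have -> : widen_ord (leqnSn m) i = lift ord_max i.
    by apply: val_inj; rewrite /= /bump leqNgt ltn_ord.
  by rewrite liftK.
- by rewrite ffunE unlift_none.
apply: fext => l ln; rewrite /upd /y ltnS [(l <= m)%N]leq_eqVlt.
case: eqP => [-> /=|_ /=].
  by rewrite (bvecE _ (ord_max : 'I_m.+1)) ffunE unlift_none.
case: ifP => // lm.
have lE : l = lift ord_max (Ordinal lm) :> nat by rewrite /= /bump leqNgt lm.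
by rewrite (bvecE phi (Ordinal lm)) [in RHS]lE bvecE ffunE liftK.
Qed.

Lemma hlift_tens (W : lmodType k) n (f : (nat -> V) -> (nat -> int) -> W) x e :
  (forall e', multilin n (f^~ e')) ->
  (forall y e1 e2, (forall l, (l < n)%N -> e1 l = e2 l) -> f y e1 = f y e2) ->
  homog n x e -> hlift f (tens n x) = f x e.
Proof.
move=> flin fdeg xe; rewrite [RHS](multilin_sum x (flin e)).
apply: eq_bigr => phi _; rewrite ffunE.
have [->|nz] := eqVneq (\prod_(i < n) coord (hbasis V) (phi i) (x i)) 0.
  by rewrite !scale0r.
congr (_ *: _); apply: fdeg => l ln.
rewrite (bdegE phi (Ordinal ln)); apply: (coord_deg (xe l ln)).
by apply: contra_neq nz => z; rewrite (bigD1 (Ordinal ln)) //= z mul0r.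
Qed.

Lemma tens_multilin n : multilin n (@tens k V n).
Proof.
split=> [x y xy|x l ln a v w].
  by apply/ffunP => phi; rewrite !ffunE; apply: eq_bigr => i _; rewrite xy.
have E z : tens n (upd x l z) = [ffun phi : {ffun 'I_n -> 'I_(gdim V)} =>
    coord (hbasis V) (phi (Ordinal ln)) z *
    \prod_(i < n | i != Ordinal ln) coord (hbasis V) (phi i) (x i)].
  apply/ffunP => phi; rewrite !ffunE (bigD1 (Ordinal ln)) //= /upd eqxx.
  by congr (_ * _); apply: eq_bigr => i; rewrite -val_eqE /= => /negPf ->.
by rewrite !E; apply/ffunP => phi; rewrite !ffunE linearP mulrDl -mulrA.
Qed.

Lemma tens_tpiece n x e :
  homog n x e -> tens n x \in tpiece V n (\sum_(l < n) e l).
Proof.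
move=> xe; rewrite (multilin_sum x (tens_multilin n)).
apply: memv_suml => phi _.
have [->|nz] := eqVneq (\prod_(i < n) coord (hbasis V) (phi i) (x i)) 0.
  by rewrite scale0r mem0v.
apply/memvZ/memv_span/mapP; exists phi => //; rewrite mem_enum inE /=.
apply/eqP/eq_bigr => i _; apply: (coord_deg (xe i (ltn_ord i))).
by apply: contra_neq nz => z; rewrite (bigD1 i) //= z mul0r.
Qed.

End TensorTheory.

(** * Operations on the tensor powers of a graded algebra *)

Definition dsum (e : nat -> int) (i : nat) : int := \sum_(l < i) e l.

Section Operations.
Variables (k : fieldType) (A : gradedAlg k).

(* a_1 . x_1 . a_2 ... a_n . x_n . a_{n+1} *)
Fixpoint interleave (n : nat) (a x : nat -> A) : A :=
  if n is m.+1 then gmul (gmul (interleave m a x) (x m)) (a m.+1) else a 0%N.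

Definition tmul n (s t : tensor A n) : tensor A n :=
  hlift (fun a da => hlift (fun b db =>
    ksgn (\sum_(i < n) \sum_(j < n | (j < i)%N) da i * db j)
      *: tens n (fun l => gmul (a l) (b l))) t) s.

(* [place N c t] puts the successive tensor factors of [t] in the positions
   listed (from 1 on) in [c], and the unit in the other positions. *)
Definition place (N : nat) (c : seq nat) n (t : tensor A n) : tensor A N :=
  hlift (fun a _ => tens N
    (fun l => if l.+1 \in c then a (index l.+1 c) else gone)) t.

(* The identification of the first tensor power with [A]. *)
Definition untens (t : tensor A 1) : A := hlift (fun a _ => a 0%N) t.

Definition Fmap n (r : tensor A n.+1) : 'Hom(tensor A n, A) :=
  linfun (fun t => hlift (fun a da => hlift (fun x dx =>
    ksgn (\sum_(i < n) \sum_(j < n.+1 | (i < j)%N) dx i * da j)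
      *: interleave n a x) t) r).

Definition gcomm (d x : A) : A :=
  hlift (fun a da => hlift (fun b db =>
    gmul (a 0%N) (b 0%N) - ksgn (da 0%N * db 0%N) *: gmul (b 0%N) (a 0%N))
    (tens 1 (fun=> x))) (tens 1 (fun=> d)).

End Operations.

Section OperationsTheory.
Variables (k : fieldType) (A : gradedAlg k).
Implicit Types (x y a b : nat -> A).

Lemma gmulP2l (c : k) (u v w : A) :
  gmul (c *: u + v) w = c *: gmul u w + gmul v w.
Proof. exact: gmul_linearl. Qed.

Lemma gmulP2r (c : k) (u v w : A) :
  gmul w (c *: u + v) = c *: gmul w u + gmul w v.
Proof. exact: gmul_linearr. Qed.

Lemma multilin_scale (W : lmodType k) n (c : k) (f : (nat -> A) -> W) :
  multilin n f -> multilin n (fun x => c *: f x).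
Proof.
case=> fe fl; split=> [x y xy|x l ln d v w]; first by rewrite (fe x y).
by rewrite fl // scalerDr !scalerA mulrC.
Qed.

Lemma multilin_hlift (W : lmodType k) n m
    (f : (nat -> A) -> (nat -> A) -> (nat -> int) -> W) (t : tensor A m) :
  (forall b db, multilin n (fun a => f a b db)) ->
  multilin n (fun a => hlift (f a) t).
Proof.
move=> H; split=> [x y xy|x l ln c v w].
  apply: eq_bigr => phi _; congr (_ *: _).
  by case: (H (bvec phi) (bdeg phi)) => + _; apply.
rewrite /hlift scaler_sumr -big_split; apply: eq_bigr => phi _ /=.
by case: (H (bvec phi) (bdeg phi)) => _ ->; rewrite // scalerDr !scalerA mulrC.
Qed.

(* Precomposition with a map acting linearly on each argument and sending the
   argument [l] to position [g l]. *)
Lemma multilin_tens N n (g : nat -> nat) (h : (nat -> A) -> nat -> A) :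
  (forall x y, (forall l, (l < n)%N -> x l = y l) ->
     forall m, (m < N)%N -> h x m = h y m) ->
  (forall l, (l < n)%N -> (g l < N)%N) ->
  (forall x l v m, (l < n)%N -> (m < N)%N -> m <> g l -> h (upd x l v) m = h x m) ->
  (forall x l c v w, (l < n)%N -> h (upd x l (c *: v + w)) (g l)
     = c *: h (upd x l v) (g l) + h (upd x l w) (g l)) ->
  multilin n (fun x => tens N (h x)).
Proof.
have [te tl] := tens_multilin A N.
move=> he gN hc hl; split=> [x y xy|x l ln c v w].
  by apply: te => m mN; apply: he.
have E z : tens N (h (upd x l z)) = tens N (upd (h x) (g l) (h (upd x l z) (g l))).
  by apply: te => m mN; rewrite /upd; case: eqP => [->//|/(hc _ _ _ _ ln mN)]; apply.
by rewrite E hl // tl ?gN // -!E.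
Qed.

Lemma tmul_tens n a da b db : homog n a da -> homog n b db ->
  tmul (tens n a) (tens n b) =
    ksgn (\sum_(i < n) \sum_(j < n | (j < i)%N) da i * db j)
      *: tens n (fun l => gmul (a l) (b l)).
Proof.
move=> ah bh; rewrite /tmul (hlift_tens _ _ ah).
- rewrite (hlift_tens _ _ bh) // => [e'|y e1 e2 ee].
    apply/multilin_scale/(multilin_tens (g := id)) => //.
    + by move=> x y xy m mn; rewrite xy.
    + by move=> x l v m _ _ ml; rewrite /upd; case: eqP.
    + by move=> x l c v w _; rewrite /upd eqxx gmulP2r.
  congr (ksgn _ *: _); apply: eq_bigr => i _; apply: eq_bigr => j _.
  by rewrite ee.
- move=> e'; apply: multilin_hlift => c dc.
  apply/multilin_scale/(multilin_tens (g := id)) => //.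
  + by move=> x y xy m mn; rewrite xy.
  + by move=> x l v m _ _ ml; rewrite /upd; case: eqP.
  + by move=> x l d v w _; rewrite /upd eqxx gmulP2l.
move=> y e1 e2 ee; apply: eq_bigr => phi _; congr (_ *: (ksgn _ *: _)).
by apply: eq_bigr => i _; apply: eq_bigr => j _; rewrite ee.
Qed.

Lemma place_tens N c n a da :
  uniq c -> size c = n -> {in c, forall p, 0 < p <= N}%N -> homog n a da ->
  place N c (tens n a) =
    tens N (fun l => if l.+1 \in c then a (index l.+1 c) else gone).
Proof.
move=> uc sc cN ah; rewrite /place (hlift_tens _ _ ah) // => e'.
have cl l : (l < n)%N -> (0 < nth 0%N c l <= N)%N.
  by move=> ln; apply: cN; rewrite mem_nth ?sc.
have gS l : (l < n)%N -> (nth 0%N c l).-1.+1 = nth 0%N c l.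
  by move=> /cl/andP[? _]; rewrite prednK.
apply: (multilin_tens (g := fun l => (nth 0%N c l).-1)).
- by move=> x y xy m mN; case: ifP => // mc; rewrite xy // -sc index_mem.
- by move=> l ln; rewrite gS //; case/andP: (cl l ln).
- move=> x l v m ln mN ml; case: ifP => // mc; rewrite /upd; case: eqP => // il.
  by case: ml; rewrite -il nth_index.
move=> x l d v w ln; rewrite gS // mem_nth ?sc // index_uniq ?sc //.
by rewrite /upd eqxx.
Qed.

Lemma untens_tens a da : homog 1 a da -> untens (tens 1 a) = a 0%N.
Proof.
move=> ah; rewrite /untens (hlift_tens _ _ ah) // => e'.
split=> [x y xy|x [|//] _ c v w]; first exact: xy.
by rewrite /upd.
Qed.

Lemma interleave_ext n a b x y :
  (forall l, (l < n.+1)%N -> a l = b l) -> (forall l, (l < n)%N -> x l = y l) ->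
  interleave n a x = interleave n b y.
Proof.
elim: n => [|n IH] ab xy /=; first exact: ab.
by rewrite (IH ) ?xy ?ab // => l ln; rewrite ?ab ?xy // ltnW.
Qed.

Lemma interleave_multilinl n x : multilin n.+1 (fun a => interleave n a x).
Proof.
elim: n => [|n [IHe IHl]].
  by split=> [a b ab|a [|//] _ c v w] /=; [exact: ab | rewrite /upd].
split=> [a b ab|a l ln c v w]; first exact: interleave_ext.
rewrite /=; have [ln'|nl] := ltnP l n.+1.
  rewrite IHl // /upd gtn_eqF // !gmulP2l //.
have -> : l = n.+1 by apply/eqP; rewrite eqn_leq nl -ltnS ln.
have E z : interleave n (upd a n.+1 z) x = interleave n a x.
  by apply: IHe => m mn; rewrite /upd ltn_eqF.
by rewrite !E /upd eqxx gmulP2r.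
Qed.

Lemma interleave_multilinr n a : multilin n (fun x => interleave n a x).
Proof.
elim: n => [|n [IHe IHl]]; first by split.
split=> [x y xy|x l ln c v w]; first exact: interleave_ext.
rewrite /=; have [ln'|nl] := ltnP l n.
  by rewrite IHl // /upd gtn_eqF // !gmulP2l.
have -> : l = n by apply/eqP; rewrite eqn_leq nl -ltnS ln.
have E z : interleave n a (upd x n z) = interleave n a x.
  by apply: IHe => m mn; rewrite /upd ltn_eqF.
by rewrite !E /upd eqxx gmulP2r gmulP2l.
Qed.

Lemma FmapE n (r : tensor A n.+1) (t : tensor A n) :
  Fmap r t = hlift (fun a da => hlift (fun x dx =>
    ksgn (\sum_(i < n) \sum_(j < n.+1 | (i < j)%N) dx i * da j)
      *: interleave n a x) t) r.
Proof.
rewrite /Fmap; set f := fun t => hlift _ r.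
have fl : linear f.
  move=> c u v; have fE t' : f t' = \sum_phi (r phi : k) *: hlift (fun x dx =>
      ksgn (\sum_(i < n) \sum_(j < n.+1 | (i < j)%N) dx i * bdeg phi j)
        *: interleave n (bvec phi) x) t' by [].
  rewrite !fE scaler_sumr -big_split /=; apply: eq_bigr => phi _.
  by rewrite hlift_is_linear scalerDr !scalerA mulrC.
pose fL : {linear tensor A n -> A} :=
  HB.pack f (GRing.isLinear.Build k (tensor A n) A _ f fl).
exact: (lfunE fL).
Qed.

Lemma Fmap_tens n a da x dx : homog n.+1 a da -> homog n x dx ->
  Fmap (tens n.+1 a) (tens n x) =
    ksgn (\sum_(i < n) \sum_(j < n.+1 | (i < j)%N) dx i * da j)
      *: interleave n a x.
Proof.
move=> ah xh; rewrite FmapE (hlift_tens _ _ ah).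
- rewrite (hlift_tens _ _ xh) // => [e'|y e1 e2 ee].
    exact/multilin_scale/interleave_multilinr.
  congr (ksgn _ *: _); apply: eq_bigr => i _; apply: eq_bigr => j _.
  by rewrite ee.
- move=> e'; apply: multilin_hlift => y dy.
  exact/multilin_scale/interleave_multilinl.
move=> y e1 e2 ee; apply: eq_bigr => phi _; congr (_ *: (ksgn _ *: _)).
by apply: eq_bigr => i _; apply: eq_bigr => j _; rewrite ee.
Qed.

Lemma gcommE p q (d x : A) : d \in gpiece A p -> x \in gpiece A q ->
  gcomm d x = gmul d x - ksgn (p * q) *: gmul x d.
Proof.
move=> dp xq; rewrite /gcomm (hlift_tens (e := fun=> p)) //.
- rewrite (hlift_tens (e := fun=> q)) // => [e'|y e1 e2 ee]; last by rewrite ee.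
  split=> [y z yz|y [|//] _ c v w]; first by rewrite yz.
  rewrite /upd /= gmulP2r gmulP2l scalerDr scalerBr !scalerA mulrC.
  by rewrite opprD addrACA.
- move=> e'; apply: multilin_hlift => b db.
  split=> [y z yz|y [|//] _ c v w]; first by rewrite yz.
  rewrite /upd /= gmulP2r gmulP2l scalerDr scalerBr !scalerA mulrC.
  by rewrite opprD addrACA.
by move=> y e1 e2 ee; apply: eq_bigr => phi _; rewrite ee.
Qed.

Lemma gcomm_is_linear (d : A) : linear (gcomm d).
Proof.
move=> c u v; have [_ tl] := tens_multilin A 1.
have T : tens 1 (fun=> c *: u + v) = c *: tens 1 (fun=> u) + tens 1 (fun=> v).
  have E z : tens 1 (fun=> z) = tens 1 (upd (fun=> 0 : A) 0 z).
    by case: (tens_multilin A 1) => + _; apply=> -[].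
  by rewrite !E tl.
have gE z : gcomm d z = \sum_phi (tens 1 (fun=> d) phi : k) *:
    hlift (fun b db => gmul (bvec phi 0%N) (b 0%N)
      - ksgn (bdeg phi 0%N * db 0%N) *: gmul (b 0%N) (bvec phi 0%N)) (tens 1 (fun=> z)).
  by [].
rewrite !gE T scaler_sumr -big_split /=; apply: eq_bigr => phi _.
by rewrite hlift_is_linear scalerDr !scalerA mulrC.
Qed.

End OperationsTheory.

(** ** Infinity-Yang-Baxter pairs *)

Section Pairs.
Variables (k : fieldType) (A : gradedAlg k).

(* A family [(r_n)] indexed by [n >= 1] is represented by [u] with
   [u n = r_{n+1}]. *)
Definition tenfam : Type := forall n : nat, tensor A n.+1.

(* The equation whose left-hand side is quadratic in the family [u]: both
   equations of a pair [(r, s)] have this shape, for [u = r] and [u = s]. *)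
Definition YB_eq (u r s : tenfam) (n : nat) : Prop :=
  \sum_(1 <= i < n) (let j := (n - i)%N in
     ksgn (1 + i%:Z) *: tmul (place n.+1 (iota 1 i.+1) (u i))
                             (place n.+1 (iota i.+1 j.+1) (u j)))
  = \sum_(1 <= l < n.+2) (let dl := place n.+1 [:: l] (r 0%N) in
       tmul dl (u n) + ksgn n%:Z *: tmul (u n) dl)
  + \sum_(1 <= i < n) \sum_(1 <= c < i.+1) (let j := (n - i)%N in
       let outer := place n.+1 (iota 1 c ++ iota (c + j).+1 (n.+1 - (c + j))) (u i) in
       ksgn (c%:Z - 1 + (j%:Z - 1) * (n%:Z - c%:Z - j%:Z - 1)) *:
         (tmul outer (place n.+1 (iota c j.+1) (r j))
          + ksgn ((1 - j%:Z) * i%:Z) *: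
            tmul (place n.+1 (iota c.+1 j.+1) (s j)) outer)).

Definition infYB_pair (r s : tenfam) : Prop :=
  [/\ forall n, r n \in tpiece A n.+1 (n.+1%:Z - 2),
      forall n, s n \in tpiece A n.+1 (n.+1%:Z - 2),
      r 0%N = s 0%N,
      gmul (untens (r 0%N)) (untens (r 0%N)) = 0
    & forall n, (0 < n)%N -> YB_eq r r s n /\ YB_eq s r s n].

(** ** Homotopy coupled Rota-Baxter operators *)

Definition is_differential (m1 : 'End(A)) : Prop :=
  [/\ forall p x, x \in gpiece A p -> m1 x \in gpiece A (p - 1),
      forall x, m1 (m1 x) = 0
    & forall p x y, x \in gpiece A p ->
        m1 (gmul x y) = gmul (m1 x) y + ksgn (- p) *: gmul x (m1 y)].

(* A family of maps [(R_n)] indexed by [n >= 1] is represented by [R] with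
   [R n = R_{n+1}]. *)
Definition opfam : Type := forall n : nat, 'Hom(tensor A n.+1, A).

(* [opval R n x] is [R_n (x_1, ..., x_n)] (for [n >= 1]). *)
Definition opval (R : opfam) (n : nat) (x : nat -> A) : A :=
  if n is m.+1 then R m (tens m.+1 x) else 0.

(* [x_1, ..., x_i, y, x_{i+q+2}, ...]: the [q + 1] arguments following the
   first [i] ones are replaced with [y]. *)
Definition splice (i q : nat) (y : A) (x : nat -> A) : nat -> A :=
  fun l => if (l < i)%N then x l else if l == i then y else x (l + q)%N.

Definition shift (i : nat) (x : nat -> A) : nat -> A := fun l => x (i + l)%N.

Definition graded_ops (R : opfam) : Prop :=
  forall n x e, homog n.+1 x e ->
    R n (tens n.+1 x) \in gpiece A (dsum e n.+1 + (n.+1%:Z - 1)).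

(* The equation with outer operators [u] ([u = R] or [u = S]), evaluated on
   homogeneous arguments [x] of degrees [e].  By the Koszul rule, the value of
   [id^i (x) h (x) id^l] carries the sign [(-1)^(|h| (e_1 + ... + e_i))], that
   of [u_i (x) u_j] the sign [(-1)^(|u_j| (e_1 + ... + e_i))] and that of
   [id (x) S_q] the sign [(-1)^(|S_q| |first argument|)]. *)
Definition RB_eq (m1 : 'End(A)) (u R S : opfam) (n : nat) : Prop :=
  forall (x : nat -> A) (e : nat -> int), homog n x e ->
  m1 (opval u n x)
  + \sum_(1 <= i < n) (let j := (n - i)%N in
      ksgn (i%:Z + 1) *: (ksgn ((j%:Z - 1) * dsum e i) *:
        gmul (opval u i x) (opval u j (shift i x))))
  = ksgn (n%:Z - 1) *: (\sum_(0 <= i < n)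
      ksgn ((-1) * dsum e i) *: opval u n (splice i 0 (m1 (x i)) x))
  + \sum_(1 <= p < n) \sum_(0 <= i < p) (let q := (n - p)%N in
      ksgn (i%:Z + (q%:Z - 1) * (p%:Z - i%:Z)) *:
        (ksgn ((q%:Z - 1) * dsum e i) *:
         opval u p (splice i q (gmul (opval R q (shift i x)) (x (i + q)%N)) x))
      + ksgn (i%:Z + (q%:Z - 1) * (p%:Z - i%:Z - 1)) *:
        (ksgn ((q%:Z - 1) * dsum e i) *:
         opval u p (splice i q
           (ksgn ((q%:Z - 1) * e i) *: gmul (x i) (opval S q (shift i.+1 x))) x))).

Definition hcRB_operator (m1 : 'End(A)) (R S : opfam) : Prop :=
  [/\ graded_ops R, graded_ops S
    & forall n, (0 < n)%N -> RB_eq m1 R R S n /\ RB_eq m1 S R S n].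

(** ** The map chi *)

Definition chi (rs : tenfam * tenfam) : 'End(A) * opfam * opfam :=
  (linfun (fun x => - gcomm (untens (rs.1 0%N)) x),
   fun n => Fmap (rs.1 n.+1), fun n => Fmap (rs.2 n.+1)).

Lemma chi1E (rs : tenfam * tenfam) (x : A) :
  (chi rs).1.1 x = - gcomm (untens (rs.1 0%N)) x.
Proof.
set d := untens _; pose f (y : A) := - gcomm d y.
have fl : linear f by move=> c u v; rewrite /f gcomm_is_linear opprD scalerN.
pose fL : {linear A -> A} := HB.pack f (GRing.isLinear.Build k A A _ f fl).
exact: (lfunE fL).
Qed.

End Pairs.

(* Main.v *)
Require Import Defs.
From HB Require Import structures.
From mathcomp Require Import all_boot all_order all_algebra.
From mathcomp Require Import boolp classical_sets functions.
From mathcomp Require Import zify ring.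

(* F sends a product of two placed tensors to a composite of their images.
   Evaluated on x_1, ..., x_n, an adjacent product r^(1..i+1) s^(i+1..n+1) gives
   F(r)(x_1, ..., x_i) F(s)(x_(i+1), ..., x_n), and the product of an outer tensor
   with an inner one, on either side, plugs F(inner)(...) x or x F(inner)(...) into
   one argument of F(outer).  The terms d^k r and r d^k of the Yang-Baxter equation
   are again such products, with one factor in the first tensor power.  Hence F
   turns the Yang-Baxter equation in A^(n+1) into the Rota-Baxter equation on n
   arguments, signs included.  For A = End(V), matrix units give an explicit right
   inverse of F respecting degrees, and F is bijective by a dimension count.
   Finally, a derivation m of degree -1 of End(V) is -[d, -] for
   d = - sum_j m(E_(j,0)) E_(0,j); this d is unique and of square zero if m is,
   because a nonzero element of nonzero degree cannot commute with all E_(j,j). *)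

Set Implicit Arguments.
Unset Strict Implicit.
Unset Printing Implicit Defensive.

Import Order.TTheory GRing.Theory Num.Theory.

Local Open Scope ring_scope.

(** * Parity of Koszul exponents *)

Section Signs.
Variable k : fieldType.

Lemma ksgnD (m n : int) : ksgn (m + n) = ksgn m * ksgn n :> k.
Proof. by rewrite /ksgn expfzDr // oppr_eq0 oner_eq0. Qed.

Lemma ksgn_double (m : int) : ksgn (m *+ 2) = 1 :> k.
Proof. by rewrite mulr2n ksgnD /ksgn -expfzMl mulrNN mulr1 exp1rz. Qed.

(** Half the difference of the exponents is an explicit argument, so that comparing two signs
    becomes an integer identity left to [ring]. *)
Lemma ksgn_even (c m n : int) : m = n + c *+ 2 -> ksgn m = ksgn n :> k.
Proof. by move=> ->; rewrite ksgnD ksgn_double mulr1. Qed.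

Lemma ksgn_odd (c m n : int) : m = n + 1 + c *+ 2 -> ksgn m = - ksgn n :> k.
Proof.
by move=> ->; rewrite ksgnD ksgn_double mulr1 ksgnD [ksgn 1]expr1z mulrN1.
Qed.

Lemma ksgnK (m : int) : ksgn m * ksgn m = 1 :> k.
Proof. by rewrite -ksgnD -mulr2n ksgn_double. Qed.

Lemma ksgn1 : ksgn 1 = -1 :> k.
Proof. exact: expr1z. Qed.

Lemma ksgn0 : ksgn 0 = 1 :> k.
Proof. exact: expr0z. Qed.

End Signs.

(** * Sums of degrees and exponents of shuffle signs *)

Section KoszulSums.
Implicit Types f g : nat -> int.

Definition shiftz i f : nat -> int := fun l => f (i + l)%N.

(* The exponent of the Koszul sign of a shuffle: each entry of [f] is moved
   past the entries of [g] of smaller index. *)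
Definition koszul n f g : int := \sum_(i < n) f i * dsum g i.

Lemma dsumS g n : dsum g n.+1 = dsum g n + g n.
Proof. by rewrite /dsum big_ord_recr. Qed.

Lemma dsum0 g : dsum g 0 = 0.
Proof. by rewrite /dsum big_ord0. Qed.

Lemma dsum_addn g m n : dsum g (m + n) = dsum g m + dsum (shiftz m g) n.
Proof.
elim: n => [|n IH]; first by rewrite addn0 dsum0 addr0.
by rewrite addnS !dsumS IH addrA.
Qed.

Lemma eq_dsum f g n : (forall l, (l < n)%N -> f l = g l) -> dsum f n = dsum g n.
Proof. by move=> fg; apply: eq_bigr => i _; apply: fg. Qed.

Lemma koszulS n f g : koszul n.+1 f g = koszul n f g + f n * dsum g n.
Proof. by rewrite /koszul big_ord_recr. Qed.

Lemma koszul0 f g : koszul 0 f g = 0.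
Proof. by rewrite /koszul big_ord0. Qed.

(** The last entry of [f] only passes entries of [g] of index below [n.-1]. This bound matters for
    F, where n+1 tensor factors meet only n arguments. *)
Lemma eq_koszul n f f' g g' :
  (forall l, (l < n)%N -> f l = f' l) -> (forall l, (l < n.-1)%N -> g l = g' l) ->
  koszul n f g = koszul n f' g'.
Proof.
move=> ff gg; apply: eq_bigr => i _; rewrite ff //; congr (_ * _).
by apply: eq_dsum => l li; apply: gg; have := ltn_ord i; lia.
Qed.

(** The last term counts the second block of [f] moving past the whole first block of [g]. *)
Lemma koszul_addn m n f g :
  koszul (m + n) f g =
    koszul m f g + koszul n (shiftz m f) (shiftz m g)
    + dsum g m * dsum (shiftz m f) n.
Proof.
elim: n => [|n IH]; first by rewrite addn0 dsum0 koszul0 mulr0 !addr0.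
rewrite addnS !koszulS dsumS IH dsum_addn /shiftz; ring.
Qed.

Lemma koszul_gt n f g :
  \sum_(i < n) \sum_(j < n | (j < i)%N) f i * g j = koszul n f g.
Proof.
apply: eq_bigr => i _; rewrite -mulr_sumr; congr (_ * _).
have le_in : (i <= n)%N by rewrite ltnW.
by rewrite /dsum [RHS](big_ord_widen n g le_in).
Qed.

(** In F the factor of index j moves past each argument of index i < j, so its exponent is [koszul]
    with the tensor factors in the moving role. *)
Lemma koszul_lt n f g :
  \sum_(i < n) \sum_(j < n.+1 | (i < j)%N) f i * g j = koszul n.+1 g f.
Proof.
rewrite (exchange_big_dep xpredT) //=; apply: eq_bigr => j _.
have le_jn : (j <= n)%N by rewrite -ltnS.
rewrite /dsum (big_ord_widen n f le_jn) mulr_sumr.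
by apply: eq_bigr => i _; rewrite mulrC.
Qed.

End KoszulSums.

(** * Interleaved products with their signs *)

Section GradedAlg.
Variables (k : fieldType) (A : gradedAlg k).
Implicit Types (x y a b : nat -> A) (e da db : nat -> int).

Lemma gmulDl (u v w : A) : gmul (u + v) w = gmul u w + gmul v w.
Proof. by rewrite -[u]scale1r gmulP2l !scale1r. Qed.
Lemma gmulDr (u v w : A) : gmul w (u + v) = gmul w u + gmul w v.
Proof. by rewrite -[u]scale1r gmulP2r !scale1r. Qed.
Lemma gmul0x (w : A) : gmul 0 w = 0.
Proof. by apply: (addrI (gmul 0 w)); rewrite -gmulDl !addr0. Qed.
Lemma gmulx0 (w : A) : gmul w 0 = 0.
Proof. by apply: (addrI (gmul w 0)); rewrite -gmulDr !addr0. Qed.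
Lemma gmulZl c (u w : A) : gmul (c *: u) w = c *: gmul u w.
Proof. by rewrite -[c *: u]addr0 gmulP2l gmul0x addr0. Qed.
Lemma gmulZr c (u w : A) : gmul w (c *: u) = c *: gmul w u.
Proof. by rewrite -[c *: u]addr0 gmulP2r gmulx0 addr0. Qed.
Lemma gmulNl (u w : A) : gmul (- u) w = - gmul u w.
Proof. by rewrite -scaleN1r gmulZl scaleN1r. Qed.
Lemma gmulNr (u w : A) : gmul w (- u) = - gmul w u.
Proof. by rewrite -scaleN1r gmulZr scaleN1r. Qed.

(** The value of F on homogeneous entries [a] and [x] of degrees [da] and [e], sign included; see
    [Fmap_homog]. *)
Definition inter n a da x e : A := ksgn (koszul n.+1 da e) *: interleave n a x.

Lemma Fmap_homog n a da x e : homog n.+1 a da -> homog n x e ->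
  Fmap (tens n.+1 a) (tens n x) = inter n a da x e.
Proof. by move=> ah xh; rewrite (Fmap_tens ah xh) koszul_lt. Qed.

Lemma eq_inter n a a' da da' x x' e e' :
  (forall l, (l <= n)%N -> a l = a' l) -> (forall l, (l <= n)%N -> da l = da' l) ->
  (forall l, (l < n)%N -> x l = x' l) -> (forall l, (l < n)%N -> e l = e' l) ->
  inter n a da x e = inter n a' da' x' e'.
Proof.
move=> aa dd xx ee; rewrite /inter (eq_koszul (f' := da') (g' := e')) //.
by rewrite (interleave_ext (b := a') (y := x')).
Qed.

Lemma interleaveS n a x :
  interleave n.+1 a x = gmul (gmul (interleave n a x) (x n)) (a n.+1).
Proof. by []. Qed.

Lemma interleave_cat m n a x :
  interleave (m + n.+1) a x =
    gmul (gmul (interleave m a x) (x m))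
         (interleave n (shift m.+1 a) (shift m.+1 x)).
Proof.
elim: n => [|n IH]; first by rewrite addn1 /shift /= addn0.
by rewrite addnS /= IH /shift /= !addSn !addnS !gmulA.
Qed.

(** The product is cut just after the argument of index m; the sign comes from the later tensor
    factors passing the first m+1 arguments. *)
Lemma inter_cat m n a da x e :
  inter (m + n.+1) a da x e =
    ksgn (dsum e m.+1 * dsum (shiftz m.+1 da) n.+1) *:
    gmul (gmul (inter m a da x e) (x m))
      (inter n (shift m.+1 a) (shiftz m.+1 da) (shift m.+1 x) (shiftz m.+1 e)).
Proof.
rewrite /inter -addSn koszul_addn interleave_cat !ksgnD.
by rewrite !(gmulZl, gmulZr) !scalerA; congr (_ *: _); ring.
Qed.

(** The factors of a product of two tensors that overlap in position m only, where the last factor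
    of [a] meets the first of [b]. With [+%R] for [op] it gives the degrees. *)
Definition amalg (T : Type) (op : T -> T -> T) m (a b : nat -> T) : nat -> T :=
  fun l => if (l < m)%N then a l else if l == m then op (a m) (b 0%N) else b (l - m)%N.

Lemma amalg_r (T : Type) (op : T -> T -> T) m (a b : nat -> T) n :
  amalg op m a b (m + n).+1 = b n.+1.
Proof.
rewrite /amalg ltnNge ltnW ?ltnS ?leq_addr // gtn_eqF ?ltnS ?leq_addr //.
by rewrite -addnS addKn.
Qed.

Lemma interleave_amalg m n a b x :
  interleave (m + n) (amalg gmul m a b) x =
    gmul (interleave m a x) (interleave n b (shift m x)).
Proof.
elim: n => [|n IH] /=.
  rewrite addn0; case: m => [|m] //=.
  rewrite {2}/amalg ltnn eqxx gmulA; congr (gmul (gmul (gmul _ _) _) _).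
  by apply: interleave_ext => // l lm; rewrite /amalg lm.
by rewrite addnS /= IH !gmulA amalg_r.
Qed.

Lemma koszul_amalg m n da db e :
  koszul (m + n).+1 (amalg +%R m da db) e =
    koszul m.+1 da e + koszul n.+1 db (shiftz m e) + dsum e m * dsum db n.+1.
Proof.
elim: n => [|n IH].
  rewrite addn0 !koszulS !koszul0 !dsumS !dsum0 /amalg ltnn eqxx.
  rewrite (eq_koszul (f' := da) (g' := e)) => [|l ->//|//]; ring.
rewrite addnS koszulS IH amalg_r -addnS dsum_addn [koszul n.+2 _ _]koszulS.
rewrite [dsum db n.+2]dsumS; ring.
Qed.

Lemma inter_amalg m n a b da db x e :
  inter (m + n) (amalg gmul m a b) (amalg +%R m da db) x e =
    ksgn (dsum e m * dsum db n.+1) *: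
    gmul (inter m a da x e) (inter n b db (shift m x) (shiftz m e)).
Proof.
rewrite /inter koszul_amalg interleave_amalg !ksgnD !(gmulZl, gmulZr) !scalerA.
by congr (_ *: _); ring.
Qed.

End GradedAlg.

(** * Vanishing exponents and positions of placed factors *)

Lemma dsum_eq0 g n : (forall l, (l < n)%N -> g l = 0) -> dsum g n = 0.
Proof. by move=> g0; apply: big1 => i _; apply: g0. Qed.

Lemma koszul_eq0 n f g :
  (forall i, (i < n)%N -> f i = 0 \/ forall l, (l < i)%N -> g l = 0) ->
  koszul n f g = 0.
Proof.
move=> H; apply: big1 => i _; have [->|/dsum_eq0 ->] := H i (ltn_ord i).
  by rewrite mul0r.
by rewrite mulr0.
Qed.

Lemma dsum_amalg m n (da db : nat -> int) :
  dsum (amalg +%R m da db) (m + n).+1 = dsum da m.+1 + dsum db n.+1.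
Proof.
elim: n => [|n IH]; last by rewrite addnS dsumS IH amalg_r !dsumS !addrA.
rewrite addn0 !dsumS dsum0 (eq_dsum (g := da)) => [|l lm].
  by rewrite /amalg ltnn eqxx; ring.
by rewrite /amalg lm.
Qed.

Lemma index_iota m n i : (m <= i < m + n)%N -> index i (iota m n) = (i - m)%N.
Proof.
case/andP=> mi im; have ltn : (i - m < n)%N by lia.
rewrite -{1}(subnKC mi) -(nth_iota 0%N m ltn) index_uniq ?size_iota //.
exact: iota_uniq.
Qed.

Section Placed.
Variable T : Type.

(** Polymorphic so as to describe both the factors of [place], padded with the unit, and their
    degrees, padded with 0. *)
Definition placed (c : seq nat) (a : nat -> T) (z : T) (l : nat) : T :=
  if l.+1 \in c then a (index l.+1 c) else z.

Lemma placed_iota p m a z l :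
  placed (iota p.+1 m) a z l = if (p <= l < p + m)%N then a (l - p)%N else z.
Proof.
rewrite /placed mem_iota addSn !ltnS; case: ifP => // plm.
by rewrite index_iota ?subSS // addSn !ltnS.
Qed.

Lemma placed_cat s j m a z l :
  placed (iota 1 s ++ iota (s + j).+1 m) a z l =
    if (l < s)%N then a l
    else if (s + j <= l < s + j + m)%N then a (l - j)%N else z.
Proof.
rewrite /placed mem_cat index_cat !mem_iota size_iota add1n !addSn !ltnS leq0n andTb.
case: ltnP => ls; first by rewrite orTb index_iota ?subSS ?subn0 // add1n !ltnS leq0n.
rewrite orFb; case: ifP => // lm.
by rewrite index_iota ?addSn ?ltnS // subSS; congr a; lia.
Qed.

End Placed.

Ltac case_ifs := repeat (case: ifP => ?); try (exfalso; lia).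

(** * Images under F of products of placed pure tensors *)

Section FmapProducts.
Variables (k : fieldType) (A : gradedAlg k).
Implicit Types (x y a b : nat -> A) (e da db : nat -> int).

Lemma Fmap_is_linear n : linear (@Fmap k A n).
Proof.
move=> c u v; apply/lfunP => t.
by rewrite add_lfunE scale_lfunE !FmapE hlift_is_linear.
Qed.
HB.instance Definition _ n :=
  GRing.isLinear.Build k (tensor A n.+1) 'Hom(tensor A n, A) _ (@Fmap k A n)
    (@Fmap_is_linear n).

Lemma homog_placed N c n a da : size c = n -> homog n a da ->
  homog N (placed c a gone) (placed c da 0).
Proof.
move=> sc ah l _; rewrite /placed; case: ifP => lc; last exact: gone_deg.
by apply: ah; rewrite -sc index_mem.
Qed.

(** Two signs arise: the explicit one from multiplying in the tensor power, and the one inside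
    [inter] from applying F. *)
Lemma Fmap_tmul_place N c1 c2 n1 n2 a da b db x e :
  uniq c1 -> size c1 = n1 -> {in c1, forall p, 0 < p <= N.+1}%N ->
  uniq c2 -> size c2 = n2 -> {in c2, forall p, 0 < p <= N.+1}%N ->
  homog n1 a da -> homog n2 b db -> homog N x e ->
  Fmap (tmul (place N.+1 c1 (tens n1 a)) (place N.+1 c2 (tens n2 b))) (tens N x) =
    ksgn (koszul N.+1 (placed c1 da 0) (placed c2 db 0)) *:
    inter N (fun l => gmul (placed c1 a gone l) (placed c2 b gone l))
      (fun l => placed c1 da 0 l + placed c2 db 0 l) x e.
Proof.
move=> u1 s1 r1 u2 s2 r2 ah bh xh.
have ah' := homog_placed (N := N.+1) s1 ah.
have bh' := homog_placed (N := N.+1) s2 bh.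
rewrite (place_tens u1 s1 r1 ah) (place_tens u2 s2 r2 bh) (tmul_tens ah' bh').
rewrite koszul_gt linearZ scale_lfunE; congr (_ *: _).
apply: Fmap_homog => // l lN; apply: gmul_deg; [exact: ah'|exact: bh'].
Qed.

Lemma mem_inter n a da x e : homog n.+1 a da -> homog n x e ->
  inter n a da x e \in gpiece A (dsum e n + dsum da n.+1).
Proof.
move=> ah xh; apply: memvZ; elim: n ah xh => [|n IH] ah xh /=.
  by rewrite dsumS !dsum0 !add0r; apply: ah.
have -> : dsum e n.+1 + dsum da n.+2 = dsum e n + dsum da n.+1 + e n + da n.+1.
  by rewrite !(dsumS _ n.+1) !(dsumS e); ring.
apply: gmul_deg; last exact: ah.
apply: gmul_deg; last exact: xh.
by apply: IH => l ln; [apply: ah | apply: xh]; rewrite ltnW.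
Qed.

Lemma homog_shift m n a da : homog (m + n) a da -> homog n (shift m a) (shiftz m da).
Proof. by move=> ah l ln; apply: ah; rewrite ltn_add2l. Qed.

Lemma homogW m n a da : (m <= n)%N -> homog n a da -> homog m a da.
Proof. by move=> mn ah l lm; apply: ah; apply: leq_trans mn. Qed.

Definition dsplice i q (p : int) e : nat -> int :=
  fun l => if (l < i)%N then e l else if l == i then p else e (l + q)%N.

Lemma homog_splice i q n p (y : A) x e : homog (n + q) x e -> y \in gpiece A p ->
  homog n (splice i q y x) (dsplice i q p e).
Proof.
move=> xh yp l ln; rewrite /splice /dsplice; case: ifP => _.
  by apply: xh; rewrite ltn_addr.
by case: ifP => // _; apply: xh; rewrite ltn_add2r.
Qed.

(** The outer factors after slot [c] pass the first c arguments and the inserted [y], which counts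
    with its degree [p]. *)
Lemma inter_splice c m q p a da (y : A) x e :
  inter (c + m.+1) a da (splice c q y x) (dsplice c q p e) =
    ksgn ((dsum e c + p) * dsum (shiftz c.+1 da) m.+1) *:
    gmul (gmul (inter c a da x e) y)
      (inter m (shift c.+1 a) (shiftz c.+1 da) (shift (c + q).+1 x) (shiftz (c + q).+1 e)).
Proof.
have cl l : (c.+1 + l < c)%N = false by lia.
have cn l : (c.+1 + l == c)%N = false by lia.
have cq l : (c.+1 + l + q = (c + q).+1 + l)%N by lia.
rewrite inter_cat; congr (ksgn (_ * _) *: gmul (gmul _ _) _).
- rewrite dsumS /dsplice ltnn eqxx; congr (_ + _).
  by apply: eq_dsum => l ->.
- by apply: eq_inter => // l lc; rewrite /splice /dsplice lc.
- by rewrite /splice ltnn eqxx.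
by apply: eq_inter => // l lc; rewrite /splice /dsplice /shift /shiftz cl cn cq.
Qed.

(** No factor of [a] stands strictly to the right of a factor of [b], so the product of tensors
    contributes no sign; [inter_amalg] then splits the value. *)
Lemma Fmap_tmul_adjacent i j a b da db x e :
  homog i.+1 a da -> homog j.+1 b db -> homog (i + j) x e ->
  Fmap (tmul (place (i + j).+1 (iota 1 i.+1) (tens i.+1 a))
             (place (i + j).+1 (iota i.+1 j.+1) (tens j.+1 b))) (tens (i + j) x) =
    ksgn (dsum e i * dsum db j.+1) *:
    gmul (Fmap (tens i.+1 a) (tens i x)) (Fmap (tens j.+1 b) (tens j (shift i x))).
Proof.
move=> ah bh xh.
rewrite (Fmap_tmul_place _ _ _ _ _ _ ah bh xh) ?iota_uniq ?size_iota //; first last.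
- by move=> p; rewrite mem_iota; lia.
- by move=> p; rewrite mem_iota; lia.
rewrite koszul_eq0 => [|l lij]; last first.
  rewrite !placed_iota; case: ifP => [li|_]; [right => m ml | by left].
  by rewrite placed_iota ifF //; lia.
rewrite (Fmap_homog ah (homogW (leq_addr _ _) xh)) (Fmap_homog bh (homog_shift xh)).
rewrite ksgn0 scale1r -inter_amalg; apply: eq_inter => // l lij.
- rewrite !placed_iota /amalg leq0n add0n subn0.
  have [li|li|->] := ltngtP l i.
  + by rewrite ltnS (ltnW li) gmulx1.
  + by rewrite ltnNge li /= addnS ltnS lij gmul1x.
  by rewrite ltnSn ifT ?subnn //; lia.
rewrite !placed_iota /amalg leq0n add0n subn0.
have [li|li|->] := ltngtP l i.
+ by rewrite ltnS (ltnW li) addr0.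
+ by rewrite ltnNge li /= addnS ltnS lij add0r.
by rewrite ltnSn ifT ?subnn //; lia.
Qed.

(** The outer factors to the right of the inner tensor pass all of it. Cutting after the argument of
    index c+j leaves on the left an amalgam of the first c+1 outer factors with [b], and on the
    right the outer tail. *)
Lemma Fmap_tmul_outer_inner c m j a b da db x e :
  homog (c + m.+1).+1 a da -> homog j.+1 b db -> homog (c + m.+1 + j) x e ->
  Fmap (tmul (place (c + m.+1 + j).+1
                (iota 1 c.+1 ++ iota (c.+1 + j).+1 m.+1) (tens (c + m.+1).+1 a))
             (place (c + m.+1 + j).+1 (iota c.+1 j.+1) (tens j.+1 b)))
       (tens (c + m.+1 + j) x) =
    ksgn (dsum e c * dsum db j.+1) *:
    Fmap (tens (c + m.+1).+1 a) (tens (c + m.+1)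
      (splice c j (gmul (Fmap (tens j.+1 b) (tens j (shift c x))) (x (c + j)%N)) x)).
Proof.
move=> ah bh xh.
have bxh : homog j (shift c x) (shiftz c e).
  by apply: homog_shift; apply: homogW xh; lia.
rewrite (Fmap_homog bh bxh).
have yh : gmul (inter j b db (shift c x) (shiftz c e)) (x (c + j)%N) \in
    gpiece A (dsum (shiftz c e) j + dsum db j.+1 + e (c + j)%N).
  by apply: gmul_deg; [exact: mem_inter | apply: xh; lia].
rewrite (Fmap_homog ah (homog_splice c xh yh)) inter_splice.
rewrite (Fmap_tmul_place _ _ _ _ _ _ ah bh xh) ?iota_uniq ?size_iota //; first last.
- by move=> p; rewrite mem_iota; lia.
- by move=> p; rewrite mem_cat !mem_iota; lia.
- by rewrite size_cat !size_iota; lia.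
- by rewrite cat_uniq !iota_uniq andbT andTb; apply/hasPn => p; rewrite !mem_iota; lia.
have -> : (c + m.+1 + j = c + j + m.+1)%N by lia.
rewrite -addSn koszul_addn koszul_eq0 => [|l lij]; last first.
  rewrite placed_cat; case: (ltnP l c.+1) => lc; [right => p pl | left].
    by rewrite placed_iota ifF //; lia.
  by rewrite ifF //; lia.
rewrite koszul_eq0 => [|l lm]; last first.
  right=> p pl; rewrite /shiftz placed_iota ifF //; lia.
have -> : dsum (placed (iota c.+1 j.+1) db 0) (c + j).+1 = dsum db j.+1.
  rewrite -addnS dsum_addn dsum_eq0 => [|l lc]; last first.
    by rewrite placed_iota ifF //; lia.
  rewrite add0r; apply: eq_dsum => l lj.
  by rewrite /shiftz placed_iota ifT ?addKn //; lia.
have -> : dsum (shiftz (c + j).+1 (placed (iota 1 c.+1 ++ iota (c.+1 + j).+1 m.+1) da 0)) m.+1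
    = dsum (shiftz c.+1 da) m.+1.
  apply: eq_dsum => l lm; rewrite /shiftz placed_cat ifF ?ifT; try lia.
  by congr da; lia.
rewrite inter_cat.
rewrite (eq_inter (a' := amalg gmul c a b) (da' := amalg +%R c da db) (x' := x) (e' := e)) //;
  first last.
- move=> l lcj; rewrite placed_iota placed_cat /amalg.
  have [lc|lc|->] := ltngtP l c; case_ifs; rewrite ?addr0 ?add0r ?subnn //.
- move=> l lcj; rewrite placed_iota placed_cat /amalg.
  have [lc|lc|->] := ltngtP l c; case_ifs; rewrite ?gmulx1 ?gmul1x ?subnn //.
rewrite inter_amalg.
set T := inter m (shift (c + j).+1 _) _ _ _.
have -> : T = inter m (shift c.+1 a) (shiftz c.+1 da) (shift (c + j).+1 x) (shiftz (c + j).+1 e).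
  apply: eq_inter => // l lm; rewrite /shift /shiftz placed_iota placed_cat.
    by case_ifs; rewrite gmulx1; congr a; lia.
  by case_ifs; rewrite addr0; congr da; lia.
have -> : dsum (shiftz (c + j).+1 (fun l =>
     placed (iota 1 c.+1 ++ iota (c.+1 + j).+1 m.+1) da 0 l
     + placed (iota c.+1 j.+1) db 0 l)) m.+1 = dsum (shiftz c.+1 da) m.+1.
  apply: eq_dsum => l lm; rewrite /shiftz placed_iota placed_cat.
  by case_ifs; rewrite addr0; congr da; lia.
rewrite [dsum e (c + j).+1]dsumS [dsum e (c + j)]dsum_addn !(gmulZl, gmulZr) !scalerA -!ksgnD !gmulA.
by congr (ksgn _ *: _); ring.
Qed.

(** The mirror case: all of [b] passes the first c+1 outer factors. The cut comes after the argument
    of index c, and the last factor of [b] is amalgamated with the outer tail. *)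
Lemma Fmap_tmul_inner_outer c m j a b da db x e :
  homog (c + m.+1).+1 a da -> homog j.+1 b db -> homog (c + m.+1 + j) x e ->
  Fmap (tmul (place (c + m.+1 + j).+1 (iota c.+2 j.+1) (tens j.+1 b))
             (place (c + m.+1 + j).+1
                (iota 1 c.+1 ++ iota (c.+1 + j).+1 m.+1) (tens (c + m.+1).+1 a)))
       (tens (c + m.+1 + j) x) =
    ksgn (dsum db j.+1 * (dsum e c.+1 + dsum da (c + m.+1).+1)) *:
    Fmap (tens (c + m.+1).+1 a) (tens (c + m.+1)
      (splice c j (gmul (x c) (Fmap (tens j.+1 b) (tens j (shift c.+1 x)))) x)).
Proof.
move=> ah bh xh.
have bxh : homog j (shift c.+1 x) (shiftz c.+1 e).
  by apply: homog_shift; apply: homogW xh; lia.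
rewrite (Fmap_homog bh bxh).
have yh : gmul (x c) (inter j b db (shift c.+1 x) (shiftz c.+1 e)) \in
    gpiece A (e c + (dsum (shiftz c.+1 e) j + dsum db j.+1)).
  by apply: gmul_deg; [apply: xh; lia | exact: mem_inter].
rewrite (Fmap_homog ah (homog_splice c xh yh)) inter_splice.
rewrite (Fmap_tmul_place _ _ _ _ _ _ bh ah xh) ?iota_uniq ?size_iota //; first last.
- by move=> p; rewrite mem_cat !mem_iota; lia.
- by rewrite size_cat !size_iota; lia.
- by rewrite cat_uniq !iota_uniq andbT andTb; apply/hasPn => p; rewrite !mem_iota; lia.
- by move=> p; rewrite mem_iota; lia.
have -> : (c + m.+1 + j = c + (j + m).+1)%N by lia.
rewrite -addSn koszul_addn koszul_eq0 => [|l lij]; last first.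
  by left; rewrite placed_iota ifF //; lia.
rewrite koszul_eq0 => [|l lm]; last first.
  rewrite /shiftz placed_iota; case: (leqP l j) => lj; [right => p pl | left].
    by rewrite placed_cat ifF ?ifF //; lia.
  by rewrite ifF //; lia.
have -> : dsum (placed (iota 1 c.+1 ++ iota (c.+1 + j).+1 m.+1) da 0) c.+1 = dsum da c.+1.
  by apply: eq_dsum => l lc; rewrite placed_cat lc.
have -> : dsum (shiftz c.+1 (placed (iota c.+2 j.+1) db 0)) (j + m).+1 = dsum db j.+1.
  rewrite -addSn dsum_addn [X in _ + X]dsum_eq0 => [|l lm]; last first.
    by rewrite /shiftz placed_iota ifF //; lia.
  rewrite addr0; apply: eq_dsum => l lj.
  by rewrite /shiftz placed_iota ifT ?addKn //; lia.
rewrite inter_cat.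
rewrite (eq_inter (a' := a) (da' := da) (x' := x) (e' := e)) //; first last.
- by move=> l lc; rewrite placed_iota placed_cat ltnS lc ifF ?add0r //; lia.
- by move=> l lc; rewrite placed_iota placed_cat ltnS lc ifF ?gmul1x //; lia.
set T := inter (j + m) _ _ _ _.
have -> : T = inter (j + m) (amalg gmul j b (shift c.+1 a))
    (amalg +%R j db (shiftz c.+1 da)) (shift c.+1 x) (shiftz c.+1 e).
  apply: eq_inter => // l ljm; rewrite /shift /shiftz placed_iota placed_cat /amalg.
    have [lc|lc|->] := ltngtP l j; case_ifs; rewrite ?gmulx1 ?gmul1x ?addKn //.
      by congr a; lia.
    by congr (gmul _ (a _)); lia.
  have [lc|lc|->] := ltngtP l j; case_ifs; rewrite ?addr0 ?add0r ?addKn //.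
    by congr da; lia.
  by congr (_ + da _); lia.
rewrite inter_amalg.
set D := dsum (shiftz c.+1 (fun l => _)) _.
have -> : D = dsum db j.+1 + dsum (shiftz c.+1 da) m.+1.
  rewrite -dsum_amalg; apply: eq_dsum => l ljm.
  rewrite /shiftz placed_iota placed_cat /amalg.
  have [lc|lc|->] := ltngtP l j; case_ifs; rewrite ?addr0 ?add0r ?addKn //.
    by congr da; lia.
  by congr (_ + da _); lia.
have -> : dsum da (c + m.+1).+1 = dsum da c.+1 + dsum (shiftz c.+1 da) m.+1.
  by rewrite -dsum_addn addSn.
have -> : shift j (shift c.+1 x) = shift (c + j).+1 x.
  by apply/funext => l; rewrite /shift addnA.
have -> : shiftz j (shiftz c.+1 e) = shiftz (c + j).+1 e.
  by apply/funext => l; rewrite /shiftz addnA.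
rewrite [dsum e c.+1]dsumS !(gmulZl, gmulZr) !scalerA -!ksgnD !gmulA.
(* The degree of [b] times that of the outer tail occurs twice on the right: in the total outer
   degree, and in the tail passing the inserted value. *)
congr (_ *: _); apply: (@ksgn_even _ (- dsum db j.+1 * dsum (shiftz c.+1 da) m.+1)).
ring.
Qed.

End FmapProducts.

(** * From pure tensors to homogeneous tensors *)

Lemma tpiece_ind (k : fieldType) (V : gradedVect k) n p (P : tensor V n -> Prop) :
  P 0 -> (forall c u v, P u -> P v -> P (c *: u + v)) ->
  (forall x e, homog n x e -> dsum e n = p -> P (tens n x)) ->
  forall t, t \in tpiece V n p -> P t.
Proof.
move=> P0 PD Pt t /(coord_span (X := in_tuple _)) ->.
elim/big_ind: _ => // [u v Pu Pv|i _].
  by rewrite -[u]scale1r; apply: PD.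
rewrite -[_ *: _]addr0; apply: PD => //.
have /mapP[phi] := mem_nth 0 (ltn_ord i).
rewrite mem_enum inE => /eqP phip ->.
apply: (Pt _ _ (homog_bvec phi)); rewrite -phip.
by apply: eq_bigr => l _; rewrite bdegE.
Qed.

Section TensorLinearity.
Variables (k : fieldType) (A : gradedAlg k).
Implicit Types (x y a b : nat -> A) (e da db : nat -> int).

Lemma placeP N c n z (u v : tensor A n) :
  place N c (z *: u + v) = z *: place N c u + place N c v.
Proof. exact: hlift_is_linear. Qed.

Lemma tmulPl n z (u v w : tensor A n) :
  tmul (z *: u + v) w = z *: tmul u w + tmul v w.
Proof. exact: hlift_is_linear. Qed.

Lemma tmulPr n z (u v w : tensor A n) :
  tmul w (z *: u + v) = z *: tmul w u + tmul w v.
Proof.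
have E (s t : tensor A n) : tmul s t = \sum_phi (s phi : k) *: hlift (fun b db =>
    ksgn (\sum_(i < n) \sum_(j < n | (j < i)%N) bdeg phi i * db j)
      *: tens n (fun l => gmul (bvec phi l) (b l))) t by [].
rewrite !E scaler_sumr -big_split /=; apply: eq_bigr => phi _.
by rewrite hlift_is_linear scalerDr !scalerA mulrC.
Qed.

Lemma tmul0l n (w : tensor A n) : tmul 0 w = 0.
Proof. exact: linear0. Qed.

Lemma tmul0r n (w : tensor A n) : tmul w 0 = 0.
Proof. by have := tmulPr (-1) 0 0 w; rewrite !scaleN1r !addNr. Qed.

Lemma place0 N c n : place N c (0 : tensor A n) = 0.
Proof. exact: linear0. Qed.

Lemma eq_tens n x y : (forall l, (l < n)%N -> x l = y l) -> tens n x = tens n y.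
Proof. by case: (tens_multilin A n) => + _; apply. Qed.

Lemma tens_splice n i q x z (u v : A) : (i < n)%N ->
  tens n (splice i q (z *: u + v) x) =
    z *: tens n (splice i q u x) + tens n (splice i q v x).
Proof.
move=> lt_in; have E w : tens n (splice i q w x) = tens n (upd (splice i q 0 x) i w).
  apply: eq_tens => l _; rewrite /upd /splice.
  by case: eqP => [->|_]; rewrite ?ltnn.
by rewrite !E; case: (tens_multilin A n) => _ ->.
Qed.

Lemma tens_splice0 n i q x : (i < n)%N -> tens n (splice i q (0 : A) x) = 0.
Proof.
by move=> lt_in; have := tens_splice q x (-1) 0 0 lt_in; rewrite !scaleN1r !addNr.
Qed.

Lemma tens_spliceZ n i q x z (u : A) : (i < n)%N ->
  tens n (splice i q (z *: u) x) = z *: tens n (splice i q u x).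
Proof. by move=> lt_in; rewrite -[z *: u]addr0 tens_splice // tens_splice0 // addr0. Qed.

Lemma FmapP n z (u v : tensor A n.+1) t : Fmap (z *: u + v) t = z *: Fmap u t + Fmap v t.
Proof. by rewrite linearP add_lfunE scale_lfunE. Qed.

Lemma Fmap0 n t : Fmap (0 : tensor A n.+1) t = 0.
Proof. by rewrite linear0 zero_lfunE. Qed.

Lemma place_id n p (t : tensor A n) : t \in tpiece A n p -> place n (iota 1 n) t = t.
Proof.
elim/tpiece_ind: t / => [|c u v Pu Pv|x e xh _]; first exact: place0.
  by rewrite placeP Pu Pv.
rewrite (place_tens _ _ _ xh) ?iota_uniq ?size_iota // => [|l]; last first.
  by rewrite mem_iota; lia.
apply: eq_tens => l ln; have := placed_iota 0 n x gone l; rewrite /placed => ->.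
by rewrite leq0n add0n ln subn0.
Qed.

(** The case of no arguments, where F is the identification of the first tensor power with the
    algebra. It lets d enter the product rules as a tensor with one factor. *)
Lemma Fmap_tens0 p (t : tensor A 1) x : t \in tpiece A 1 p ->
  Fmap t (tens 0 x) = untens t.
Proof.
elim/tpiece_ind: t / => [|c u v Pu Pv|a da ah _]; first by rewrite Fmap0 /untens linear0.
  by rewrite FmapP Pu Pv /untens hlift_is_linear.
rewrite (Fmap_homog ah (x := x) (e := da)) // (untens_tens ah) /inter koszulS koszul0.
by rewrite dsum0 mulr0 addr0 ksgn0 scale1r.
Qed.

Lemma mem_untens p (t : tensor A 1) : t \in tpiece A 1 p -> untens t \in gpiece A p.
Proof.
elim/tpiece_ind: t / => [|c u v Pu Pv|a da ah <-].
- by rewrite /untens linear0 mem0v.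
- by rewrite /untens hlift_is_linear memvD ?memvZ.
by rewrite (untens_tens ah) dsumS dsum0 add0r ah.
Qed.

Lemma mem_Fmap n q (t : tensor A n.+1) x e : homog n x e -> t \in tpiece A n.+1 q ->
  Fmap t (tens n x) \in gpiece A (dsum e n + q).
Proof.
move=> xh; elim/tpiece_ind: t / => [|c u v Pu Pv|a da ah <-].
- by rewrite Fmap0 mem0v.
- by rewrite FmapP memvD ?memvZ.
by rewrite (Fmap_homog ah xh) mem_inter.
Qed.

(** Both sides are linear in each tensor, which reduces the claim to pure ones. The size is a
    variable tied by [n = i + j], because in [YB_eq] the index j is written n - i. *)
Lemma Fmap_adjacent n i j p q (u : tensor A i.+1) (t : tensor A j.+1) x e :
  n = (i + j)%N -> u \in tpiece A i.+1 p -> t \in tpiece A j.+1 q -> homog n x e ->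
  Fmap (tmul (place n.+1 (iota 1 i.+1) u) (place n.+1 (iota i.+1 j.+1) t)) (tens n x) =
    ksgn (dsum e i * q) *: gmul (Fmap u (tens i x)) (Fmap t (tens j (shift i x))).
Proof.
move=> -> up tq xh; elim/tpiece_ind: u / up => [|c u v Pu Pv|a da ah _].
- by rewrite place0 tmul0l !Fmap0 gmul0x scaler0.
- rewrite placeP tmulPl !FmapP Pu Pv gmulP2l scalerDr !scalerA.
  by rewrite [c * _]mulrC.
elim/tpiece_ind: t / tq => [|c u v Pu Pv|b db bh <-].
- by rewrite place0 tmul0r !Fmap0 gmulx0 scaler0.
- rewrite placeP tmulPr !FmapP Pu Pv gmulP2r scalerDr !scalerA.
  by rewrite [c * _]mulrC.
exact: (Fmap_tmul_adjacent ah bh xh).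
Qed.

Lemma Fmap_outer_inner n c i j p q (u : tensor A i.+1) (t : tensor A j.+1) x e :
  n = (i + j)%N -> (c < i)%N -> u \in tpiece A i.+1 p -> t \in tpiece A j.+1 q ->
  homog n x e ->
  Fmap (tmul (place n.+1 (iota 1 c.+1 ++ iota (c.+1 + j).+1 (n.+1 - (c.+1 + j))) u)
             (place n.+1 (iota c.+1 j.+1) t)) (tens n x) =
    ksgn (dsum e c * q) *:
    Fmap u (tens i
      (splice c j (gmul (Fmap t (tens j (shift c x))) (x (c + j)%N)) x)).
Proof.
move=> -> ci up tq xh.
have -> : ((i + j).+1 - (c.+1 + j) = (i - c.+1).+1)%N by lia.
have [m Ei] : exists m, i = (c + m.+1)%N by exists (i - c.+1)%N; lia.
have -> : (i - c.+1 = m)%N by lia.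
(* The type of [u] depends on [i], so the equation is eliminated in [u] and its hypotheses
   together. *)
case: _ / (esym Ei) in u ci up xh *.
elim/tpiece_ind: u / up => [|z u v Pu Pv|a da ah _].
- by rewrite place0 tmul0l !Fmap0 scaler0.
- rewrite placeP tmulPl !FmapP Pu Pv scalerDr !scalerA.
  by rewrite [z * _]mulrC.
elim/tpiece_ind: t / tq => [|z u v Pu Pv|b db bh <-].
- by rewrite place0 tmul0r !Fmap0 gmul0x tens_splice0 // linear0 scaler0.
- rewrite placeP tmulPr !FmapP Pu Pv gmulP2l tens_splice // linearP scalerDr !scalerA.
  by rewrite [z * _]mulrC.
exact: (Fmap_tmul_outer_inner ah bh xh).
Qed.

Lemma Fmap_inner_outer n c i j p q (u : tensor A i.+1) (t : tensor A j.+1) x e :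
  n = (i + j)%N -> (c < i)%N -> u \in tpiece A i.+1 p -> t \in tpiece A j.+1 q ->
  homog n x e ->
  Fmap (tmul (place n.+1 (iota c.+2 j.+1) t)
             (place n.+1 (iota 1 c.+1 ++ iota (c.+1 + j).+1 (n.+1 - (c.+1 + j))) u))
       (tens n x) =
    ksgn (q * (dsum e c.+1 + p)) *:
    Fmap u (tens i
      (splice c j (gmul (x c) (Fmap t (tens j (shift c.+1 x)))) x)).
Proof.
move=> -> ci up tq xh.
have -> : ((i + j).+1 - (c.+1 + j) = (i - c.+1).+1)%N by lia.
have [m Ei] : exists m, i = (c + m.+1)%N by exists (i - c.+1)%N; lia.
have -> : (i - c.+1 = m)%N by lia.
case: _ / (esym Ei) in u ci up xh *.
elim/tpiece_ind: u / up => [|z u v Pu Pv|a da ah <-].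
- by rewrite place0 tmul0r !Fmap0 scaler0.
- rewrite placeP tmulPr !FmapP Pu Pv scalerDr !scalerA.
  by rewrite [z * _]mulrC.
elim/tpiece_ind: t / tq => [|z u v Pu Pv|b db bh <-].
- by rewrite place0 tmul0l !Fmap0 gmulx0 tens_splice0 // linear0 scaler0.
- rewrite placeP tmulPl !FmapP Pu Pv gmulP2r tens_splice // linearP scalerDr !scalerA.
  by rewrite [z * _]mulrC.
exact: (Fmap_tmul_inner_outer ah bh xh).
Qed.

End TensorLinearity.

(** Coordinates are dual to the basis, so the pure tensor of basis vectors indexed by [phi] is the
    indicator function of [phi]. *)
Lemma tensor_tens (k : fieldType) (V : gradedVect k) n (t : tensor V n) :
  t = \sum_phi (t phi : k) *: tens n (bvec phi).
Proof.
apply/ffunP => psi; rewrite sum_ffunE (bigD1 psi) //= big1 => [|phi neq].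
  rewrite addr0 !ffunE big1 => [|i _]; first exact/esym/mulr1.
  by rewrite bvecE coord_free ?eqxx //; apply: basis_free (hbasisP V).
rewrite !ffunE; have /existsP[i ni] : [exists i, psi i != phi i].
  apply: contraR neq => /existsPn H; apply/eqP/ffunP => i.
  by have := H i; rewrite negbK => /eqP.
rewrite (bigD1 i) //= bvecE coord_free; last exact: basis_free (hbasisP V).
by rewrite eq_sym -val_eqE eq_sym in ni *; rewrite (negPf ni) mul0r; exact: mulr0.
Qed.

Lemma lfun_tensP (k : fieldType) (V : gradedVect k) (W : vectType k) n
    (f g : 'Hom(tensor V n, W)) :
  (forall x e, homog n x e -> f (tens n x) = g (tens n x)) -> f = g.
Proof.
move=> fg; apply/lfunP => t; rewrite [t]tensor_tens !linear_sum.
apply: eq_bigr => phi _; rewrite !linearZ /=; congr (_ *: _).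
exact/fg/homog_bvec.
Qed.

(** * From the Yang-Baxter to the Rota-Baxter equation *)

Section PairsToOperators.
Variables (k : fieldType) (A : gradedAlg k).
Implicit Types (x : nat -> A) (e : nat -> int) (u r s : tenfam A).

(** The operator components of [chi]. Index 0, the differential, is dropped; seen through [opval],
    the n-th operator is the image of [r n]. *)
Definition FmapS (r : tenfam A) : opfam A := fun n => Fmap (r n.+1).

Definition fam_deg (r : tenfam A) : Prop :=
  forall n, r n \in tpiece A n.+1 (n.+1%:Z - 2).

Lemma fam_deg_tpiece r n : fam_deg r -> r n \in tpiece A n.+1 (n%:Z - 1).
Proof. by move=> /(_ n); rewrite (_ : n.+1%:Z - 2 = n%:Z - 1) //; lia. Qed.

Lemma opval_Fmap r n x : (0 < n)%N -> opval (FmapS r) n x = Fmap (r n) (tens n x).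
Proof. by case: n. Qed.

Lemma Fmap_sum n (I : Type) (l : seq I) (P : pred I) (F : I -> tensor A n.+1) t :
  Fmap (\sum_(i <- l | P i) F i) t = \sum_(i <- l | P i) Fmap (F i) t.
Proof. by rewrite linear_sum sum_lfunE. Qed.

Lemma FmapZ n c (t : tensor A n.+1) w : Fmap (c *: t) w = c *: Fmap t w.
Proof. by rewrite linearZ scale_lfunE. Qed.

Lemma FmapZr n c (t : tensor A n.+1) w : Fmap t (c *: w) = c *: Fmap t w.
Proof. exact: linearZ. Qed.

Lemma FmapDr n (t : tensor A n.+1) v w : Fmap t (v + w) = Fmap t v + Fmap t w.
Proof. exact: linearD. Qed.

Lemma FmapD n (s t : tensor A n.+1) w : Fmap (s + t) w = Fmap s w + Fmap t w.
Proof. by rewrite linearD add_lfunE. Qed.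

Lemma Fmap_quadratic u n x e : fam_deg u -> homog n x e ->
  Fmap (\sum_(1 <= i < n) (let j := (n - i)%N in
     ksgn (1 + i%:Z) *: tmul (place n.+1 (iota 1 i.+1) (u i))
                             (place n.+1 (iota i.+1 j.+1) (u j)))) (tens n x) =
  \sum_(1 <= i < n) (let j := (n - i)%N in
      ksgn (i%:Z + 1) *: (ksgn ((j%:Z - 1) * dsum e i) *:
        gmul (opval (FmapS u) i x) (opval (FmapS u) j (shift i x)))).
Proof.
move=> ud xh; rewrite Fmap_sum; apply: eq_big_nat => i /andP[i_gt0 lt_in] /=.
rewrite FmapZ [1 + i%:Z]addrC; congr (_ *: _).
have En : n = (i + (n - i))%N by lia.
rewrite (Fmap_adjacent En (fam_deg_tpiece i ud) (fam_deg_tpiece (n - i) ud) xh).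
by rewrite !opval_Fmap ?subn_gt0 // mulrC.
Qed.

(** The sums match term by term, position c+1 of the tensor equation corresponding to slot c of the
    outer operator; only the signs remain to be compared. *)
Lemma Fmap_coupled u r s n x e : fam_deg u -> fam_deg r -> fam_deg s -> homog n x e ->
  Fmap (\sum_(1 <= i < n) \sum_(1 <= c < i.+1) (let j := (n - i)%N in
       let outer := place n.+1 (iota 1 c ++ iota (c + j).+1 (n.+1 - (c + j))) (u i) in
       ksgn (c%:Z - 1 + (j%:Z - 1) * (n%:Z - c%:Z - j%:Z - 1)) *:
         (tmul outer (place n.+1 (iota c j.+1) (r j))
          + ksgn ((1 - j%:Z) * i%:Z) *:
            tmul (place n.+1 (iota c.+1 j.+1) (s j)) outer))) (tens n x) =
  \sum_(1 <= p < n) \sum_(0 <= i < p) (let q := (n - p)%N in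
      ksgn (i%:Z + (q%:Z - 1) * (p%:Z - i%:Z)) *:
        (ksgn ((q%:Z - 1) * dsum e i) *:
         opval (FmapS u) p
           (splice i q (gmul (opval (FmapS r) q (shift i x)) (x (i + q)%N)) x))
      + ksgn (i%:Z + (q%:Z - 1) * (p%:Z - i%:Z - 1)) *:
        (ksgn ((q%:Z - 1) * dsum e i) *:
         opval (FmapS u) p (splice i q
           (ksgn ((q%:Z - 1) * e i) *:
              gmul (x i) (opval (FmapS s) q (shift i.+1 x))) x))).
Proof.
move=> ud rd sd xh; rewrite Fmap_sum; apply: eq_big_nat => i /andP[i_gt0 lt_in].
have En : n = (i + (n - i))%N by lia.
rewrite Fmap_sum big_add1; apply: eq_big_nat => c /andP[_ lt_ci] /=.
have En' : n%:Z = i%:Z + (n - i)%N%:Z by rewrite {1}En PoszD.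
have Ec : c.+1%:Z = c%:Z + 1 by rewrite -addn1 PoszD.
set j := (n - i)%N in En En' *; have j_gt0 : (0 < j)%N by rewrite subn_gt0.
rewrite FmapZ FmapD FmapZ !opval_Fmap //.
rewrite (Fmap_outer_inner En lt_ci (fam_deg_tpiece i ud) (fam_deg_tpiece j rd) xh).
rewrite (Fmap_inner_outer En lt_ci (fam_deg_tpiece i ud) (fam_deg_tpiece j sd) xh).
rewrite tens_spliceZ // FmapZr scalerDr !scalerA -!ksgnD En' Ec dsumS.
(* In both summands the two exponents differ by 2(j - 1). *)
congr (_ *: _ + _ *: _); apply: (@ksgn_even _ (- (j%:Z - 1))); ring.
Qed.

Lemma gcomm0 r p (y : A) : fam_deg r -> y \in gpiece A p ->
  gcomm (untens (r 0%N)) y =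
    gmul (untens (r 0%N)) y - ksgn (- p) *: gmul y (untens (r 0%N)).
Proof.
by move=> rd yp; rewrite (gcommE (mem_untens (rd 0%N)) yp) (_ : _ * p = - p) //; ring.
Qed.

(** The extreme products, d in position 1 on the left and d in position n+1 on the right, give the
    commutator of d with the value. Each other product multiplies one argument by d, and the left
    and right multiplications of the same argument pair up into its commutator. *)
Lemma Fmap_differential u r n x e : fam_deg u -> fam_deg r -> (0 < n)%N -> homog n x e ->
  Fmap (\sum_(1 <= l < n.+2) (let dl := place n.+1 [:: l] (r 0%N) in
       tmul dl (u n) + ksgn n%:Z *: tmul (u n) dl)) (tens n x) =
  gcomm (untens (r 0%N)) (opval (FmapS u) n x)
  + ksgn (n%:Z - 1) *: (\sum_(0 <= i < n) ksgn ((-1) * dsum e i) *: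
      opval (FmapS u) n (splice i 0 (- gcomm (untens (r 0%N)) (x i)) x)).
Proof.
move=> ud rd n_gt0 xh; set d := untens _.
have ut := fam_deg_tpiece n ud; have rt := fam_deg_tpiece 0 rd.
have Ed y : Fmap (r 0%N) (tens 0 y) = d by exact: Fmap_tens0 rt.
(* Occupying every position, [u n] counts as a placed tensor, so the product rules apply with d as
   the inner or adjacent factor. *)
have pid : place n.+1 (iota 1 n.+1) (u n) = u n by exact: place_id ut.
have outer c : (c < n)%N ->
    place n.+1 (iota 1 c.+1 ++ iota (c.+1 + 0).+1 (n.+1 - (c.+1 + 0))) (u n) = u n.
  move=> cn; rewrite addn0 -[(c.+1).+1]add1n -iotaD.
  by rewrite (_ : c.+1 + (n.+1 - c.+1) = n.+1)%N //; lia.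
have En : n = (n + 0)%N by rewrite addn0.
have dr c : (c < n)%N -> Fmap (tmul (u n) (place n.+1 [:: c.+1] (r 0%N))) (tens n x) =
    ksgn (- dsum e c) *: Fmap (u n) (tens n (splice c 0 (gmul d (x c)) x)).
  move=> cn; have := Fmap_outer_inner En cn ut rt xh.
  by rewrite outer // Ed addn0 sub0r mulrN1.
have dl c : (c < n)%N -> Fmap (tmul (place n.+1 [:: c.+2] (r 0%N)) (u n)) (tens n x) =
    ksgn (- (dsum e c.+1 + (n%:Z - 1))) *:
    Fmap (u n) (tens n (splice c 0 (gmul (x c) d) x)).
  move=> cn; have := Fmap_inner_outer En cn ut rt xh.
  by rewrite outer // Ed sub0r mulN1r.
have dl0 : Fmap (tmul (place n.+1 [:: 1%N] (r 0%N)) (u n)) (tens n x) =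
    gmul d (Fmap (u n) (tens n x)).
  have := Fmap_adjacent (add0n n : n = (0 + n)%N) rt ut xh.
  rewrite pid Ed dsum0 mul0r ksgn0 scale1r => ->.
  by congr (gmul _ (Fmap _ _)); apply: eq_tens.
have drn : Fmap (tmul (u n) (place n.+1 [:: n.+1] (r 0%N))) (tens n x) =
    ksgn (- dsum e n) *: gmul (Fmap (u n) (tens n x)) d.
  have := Fmap_adjacent En ut rt xh.
  by rewrite pid Ed sub0r mulrN1.
rewrite Fmap_sum big_add1 /= (eq_big_nat _ _ (F2 := fun l =>
   Fmap (tmul (place n.+1 [:: l.+1] (r 0%N)) (u n)) (tens n x) +
   ksgn n%:Z *: Fmap (tmul (u n) (place n.+1 [:: l.+1] (r 0%N))) (tens n x)));
  last by move=> l _; rewrite FmapD FmapZ.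
rewrite big_split /= big_nat_recl // big_nat_recr //= dl0 drn opval_Fmap //.
have Fh := mem_Fmap xh ut.
rewrite (gcomm0 rd Fh) -/d -!addrA; congr (_ + _).
rewrite addrA -big_split /= addrC; congr (_ + _).
  rewrite scalerA -ksgnD -scaleNr; congr (_ *: _).
  rewrite -[RHS]mulN1r -(ksgn1 k) -ksgnD.
  by apply: (@ksgn_even _ (n%:Z - 1)); ring.
rewrite scaler_sumr; apply: eq_big_nat => c /andP[_ cn].
have xc : x c \in gpiece A (e c) by exact: xh.
rewrite dl // dr // opval_Fmap // (gcomm0 rd xc) -/d opprB addrC tens_splice //.
rewrite -[- gmul d _]scaleN1r tens_spliceZ // FmapDr !FmapZr !scalerDr !scalerA -!ksgnD.
rewrite addrC dsumS; congr (_ *: _ + _ *: _).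
  by apply: (@ksgn_even _ (- (n%:Z - 1))); ring.
rewrite -(ksgn1 k) -!ksgnD.
by congr ksgn; ring.
Qed.

(** Evaluating the image of the tensor equation gives the operator equation, once the commutator of
    d with the value changes sides and becomes [m1] of it. Injectivity of F gives the converse. A
    free outer family [u] covers both equations of a pair. *)
Lemma RB_eq_Fmap u r s (m1 : 'End(A)) n :
  fam_deg u -> fam_deg r -> fam_deg s -> (0 < n)%N ->
  (forall y, m1 y = - gcomm (untens (r 0%N)) y) -> injective (@Fmap k A n) ->
  YB_eq u r s n <-> RB_eq m1 (FmapS u) (FmapS r) (FmapS s) n.
Proof.
move=> ud rd sd n_gt0 m1E Finj.
set d := untens (r 0%N) in m1E.
split=> [YB x e xh | RB].
  have := congr1 (fun t => Fmap t (tens n x)) YB; rewrite FmapD.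
  rewrite (Fmap_quadratic ud xh) (Fmap_differential ud rd n_gt0 xh).
  rewrite (Fmap_coupled ud rd sd xh) m1E => ->.
  by rewrite -addrA addKr; under [in RHS]eq_bigr do rewrite m1E.
apply: Finj; apply: lfun_tensP => x e xh; rewrite FmapD.
rewrite (Fmap_quadratic ud xh) (Fmap_differential ud rd n_gt0 xh).
rewrite (Fmap_coupled ud rd sd xh); have := RB x e xh.
by under [in X in _ = X -> _]eq_bigr do rewrite m1E; rewrite m1E -addrA => <-; rewrite addNKr.
Qed.
End PairsToOperators.

(** * Matrix units of End(V) *)

Section EndMatrixUnits.
Variables (k : fieldType) (V : gradedVect k).
Local Notation A := (endAlg V).
Local Notation I := 'I_(gdim V).
Implicit Types (e : nat -> int).

Definition munit (i j : I) : A :=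
  linfun (fun w : V => coord (hbasis V) j w *: (hbasis V)`_i).

Lemma munitE (i j : I) (w : V) :
  (munit i j : 'End(V)) w = coord (hbasis V) j w *: (hbasis V)`_i.
Proof.
pose f w := coord (hbasis V) j w *: (hbasis V)`_i.
have fl : linear f by move=> a u v; rewrite /f linearP scalerDl scalerA.
pose fL : {linear V -> V} := HB.pack f (GRing.isLinear.Build k V V _ f fl).
exact: (lfunE fL).
Qed.

Lemma coord_hbasisE (i j : I) : coord (hbasis V) j (hbasis V)`_i = (i == j)%:R.
Proof. by rewrite coord_free //; apply: basis_free (hbasisP V). Qed.

Definition entry (i j : I) (f : A) : k^o := coord (hbasis V) i ((f : 'End(V)) (hbasis V)`_j).

Lemma entry_munit i j l m : entry l m (munit i j) = ((l == i) && (m == j))%:R.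
Proof.
rewrite /entry munitE linearZ /= !coord_hbasisE -natrM mulnb andbC.
by rewrite [i == l]eq_sym.
Qed.

Lemma entry_inj (f g : A) : (forall i j, entry i j f = entry i j g) -> f = g.
Proof.
move=> fg; apply: lfun_hbasisP => j.
by rewrite [LHS]coord_hbasis [RHS]coord_hbasis; apply: eq_bigr => i _; rewrite [coord _ _ _]fg.
Qed.

Lemma entryP c (f g : A) i j : entry i j (c *: f + g) = c * entry i j f + entry i j g.
Proof. by rewrite /entry add_lfunE scale_lfunE linearP. Qed.

Lemma entry_gmul (f g : A) i j : entry i j (gmul f g) = \sum_l entry i l f * entry l j g.
Proof.
rewrite /entry comp_lfunE [in LHS](coord_hbasis ((g : 'End(V)) _)) !linear_sum.
by apply: eq_bigr => l _; rewrite !linearZ /= mulrC.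
Qed.

HB.instance Definition _ i j :=
  GRing.isLinear.Build k A k^o _ (entry i j) (fun c f g => entryP c f g i j).

Lemma entry_sum (J : Type) (s : seq J) (P : pred J) (F : J -> A) i j :
  entry i j (\sum_(l <- s | P l) F l) = \sum_(l <- s | P l) entry i j (F l).
Proof. exact: linear_sum. Qed.

Lemma entryZ c (f : A) i j : entry i j (c *: f) = c * entry i j f.
Proof. exact: linearZ. Qed.

Lemma munit_sum (f : A) : f = \sum_i \sum_j entry i j f *: munit i j.
Proof.
apply: entry_inj => l m; rewrite entry_sum (bigD1 l) //= [X in _ + X]big1 => [|i il].
  rewrite addr0 entry_sum (bigD1 m) //= big1 => [|j jm].
    by rewrite addr0 entryZ entry_munit !eqxx mulr1.
  by rewrite entryZ entry_munit [m == j]eq_sym (negPf jm) andbF mulr0.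
rewrite entry_sum big1 // => j _.
by rewrite entryZ entry_munit [l == i]eq_sym (negPf il) mulr0.
Qed.

Lemma munit_ind (P : A -> Prop) :
  P 0 -> (forall c u v, P u -> P v -> P (c *: u + v)) -> (forall i j, P (munit i j)) ->
  forall f, P f.
Proof.
move=> P0 PD Pu f; have PA u v : P u -> P v -> P (u + v).
  by move=> ? ?; rewrite -[u]scale1r; apply: PD.
rewrite [f]munit_sum; elim/big_ind: _ => // i _; elim/big_ind: _ => // j _.
by rewrite -[_ *: _]addr0; apply: PD.
Qed.

Lemma munit_gmul i j l m : gmul (munit i j) (munit l m) = (j == l)%:R *: munit i m :> A.
Proof.
apply: lfun_hbasisP => n; rewrite scale_lfunE [LHS]comp_lfunE !munitE linearZ /=.
by rewrite !coord_hbasisE scalerA mulrC -scalerA [l == j]eq_sym scalerA.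
Qed.

Lemma munit_deg i j : munit i j \in gpiece A (hdeg i - hdeg j).
Proof.
apply/mem_endpiece_basis => l; rewrite munitE coord_hbasisE.
case: eqP => [->|_]; last by rewrite scale0r mem0v.
by rewrite scale1r addrC subrK hbasis_homog.
Qed.

Lemma entry_deg p (f : A) i j : f \in gpiece A p -> entry i j f != 0 -> hdeg i = hdeg j + p.
Proof. by move=> /mem_endpiece_basis/(_ j); apply: coord_deg. Qed.

(** The basis [hbasis A] of End(V) need not consist of matrix units, so multilinearity is used to
    pass to them one argument at a time. *)
Lemma lfun_munitP (W : vectType k) n (f g : 'Hom(tensor A n, W)) :
  (forall x, (forall l, (l < n)%N -> exists ij, x l = munit ij.1 ij.2) ->
     f (tens n x) = g (tens n x)) -> f = g.
Proof.
move=> fg; apply: lfun_tensP => x _ _.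
(* Induction on the number m of leading arguments that are still arbitrary. *)
suff H m : (m <= n)%N -> forall y,
    (forall l, (m <= l < n)%N -> exists ij, y l = munit ij.1 ij.2) ->
    f (tens n y) = g (tens n y).
  by apply: (H n) => // l; lia.
elim: m => [_ y yu|m IH mn y yu]; first by apply: fg => l ln; apply: yu.
have [_ tl] := tens_multilin A n.
have -> : tens n y = tens n (upd y m (y m)).
  by apply: eq_tens => l _; rewrite /upd; case: eqP => [->|].
have lin (h : 'Hom(tensor A n, W)) c u v : h (tens n (upd y m (c *: u + v))) =
    c *: h (tens n (upd y m u)) + h (tens n (upd y m v)).
  by rewrite tl // linearP.
elim/munit_ind: (y m) => [|c u v Pu Pv|i j].
- have z (h : 'Hom(tensor A n, W)) : h (tens n (upd y m 0)) = 0.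
    by have := lin h (-1) 0 0; rewrite !scaleN1r !addNr.
  by rewrite !z.
- by rewrite !lin Pu Pv.
apply: IH; first exact: ltnW.
move=> l /andP[ml ln]; rewrite /upd; case: eqP => [_|/eqP lm]; first by exists (i, j).
by apply: yu; lia.
Qed.

(** Neighbouring matrix units multiply to zero unless their adjacent indices agree; otherwise only
    the outermost indices survive. *)
Lemma interleave_munit m (row col : nat -> I) (q : nat -> I * I) :
  interleave m (fun l => munit (row l) (col l) : A) (fun l => munit (q l).1 (q l).2) =
    \prod_(l < m) ((col l == (q l).1) && ((q l).2 == row l.+1))%:R *:
    munit (row 0%N) (col m).
Proof.
elim: m => [|m IH]; first by rewrite big_ord0 scale1r.
rewrite interleaveS IH !gmulZl !munit_gmul gmulZl munit_gmul !scalerA big_ord_recr /=.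
by rewrite -mulrA -natrM mulnb.
Qed.

(** * Inverting F on End(V) *)

Section FmapInverse.
Variable n : nat.

(** The default value matters at index n: below it is (b, a), whose first component b becomes the
    last column index in [fcol]. *)
Definition extz (z : I * I) (p : {ffun 'I_n -> I * I}) (l : nat) : I * I :=
  if insub l is Some i then p i else z.

(* [E_(a, p_0.1) (x) E_(p_0.2, p_1.1) (x) ... (x) E_(p_(n-1).2, b)]: interleaved
   with matrix units [E_(q_0)], ..., [E_(q_(n-1))], it gives [E_(a, b)] if [q = p],
   and 0 otherwise. *)
Definition frow ab p (l : nat) : I := if l is m.+1 then (extz (ab.2, ab.1) p m).2 else ab.1.
Definition fcol ab p (l : nat) : I := (extz (ab.2, ab.1) p l).1.
Definition fout ab p (l : nat) : A := munit (frow ab p l) (fcol ab p l).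
Definition fodeg ab p (l : nat) : int := hdeg (frow ab p l) - hdeg (fcol ab p l).
Definition farg ab p (l : nat) : A :=
  munit (extz (ab.2, ab.1) p l).1 (extz (ab.2, ab.1) p l).2.
Definition fadeg ab p (l : nat) : int :=
  hdeg (extz (ab.2, ab.1) p l).1 - hdeg (extz (ab.2, ab.1) p l).2.

Lemma homog_fout ab p : homog n.+1 (fout ab p) (fodeg ab p).
Proof. by move=> l _; apply: munit_deg. Qed.

Lemma homog_farg ab p : homog n (farg ab p) (fadeg ab p).
Proof. by move=> l _; apply: munit_deg. Qed.

Lemma extzE z p (i : 'I_n) : extz z p i = p i.
Proof. by rewrite /extz valK. Qed.

Lemma fcol_n ab p : fcol ab p n = ab.2.
Proof. by rewrite /fcol /extz insubF ?ltnn. Qed.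

Lemma interleave_fout ab p p' :
  interleave n (fout ab p) (farg ab p') = (p == p')%:R *: munit ab.1 ab.2.
Proof.
rewrite interleave_munit fcol_n; congr (_ *: _); have [->|neq] := eqVneq p p'.
  by rewrite big1 // => l _; rewrite /fcol /= !eqxx.
have /existsP[i ni] : [exists i, p i != p' i].
  apply: contraR neq => /existsPn H; apply/eqP/ffunP => i.
  by have := H i; rewrite negbK => /eqP.
rewrite (bigD1 i) //= /fcol !extzE [(p' i).2 == _]eq_sym.
by rewrite (_ : _ && _ = (p i == p' i)) // (negPf ni) mul0r.
Qed.

(** Interleaving [fout] with [farg] telescopes to E_(a, b), so their degrees add up to that of E_(a,
    b). *)
Lemma dsum_fodeg ab p : dsum (fodeg ab p) n.+1 = hdeg ab.1 - hdeg ab.2 - dsum (fadeg ab p) n.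
Proof.
suff H m : dsum (fodeg ab p) m.+1 = hdeg ab.1 - hdeg (fcol ab p m) - dsum (fadeg ab p) m.
  by rewrite H fcol_n.
elim: m => [|m IH]; first by rewrite dsumS !dsum0 subr0 add0r.
rewrite dsumS IH dsumS /fodeg /fadeg /fcol /=; ring.
Qed.

(** The coefficient is the (a, b) entry of the value of [f] at the matrix units indexed by [p], with
    the sign that cancels the one produced by F. *)
Definition Finv (f : 'Hom(tensor A n, A)) : tensor A n.+1 :=
  \sum_(ab : I * I) \sum_(p : {ffun 'I_n -> I * I})
    (ksgn (koszul n.+1 (fodeg ab p) (fadeg ab p)) * entry ab.1 ab.2 (f (tens n (farg ab p))))
      *: tens n.+1 (fout ab p).

Lemma FinvK f : Fmap (Finv f) = f.
Proof.
apply: lfun_munitP => x xu.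
have /fin_all_exists[q qx] (i : 'I_n) : exists ij, x i = munit ij.1 ij.2.
  by apply: xu.
pose p := [ffun i => q i].
have xE ab : tens n x = tens n (farg ab p).
  by apply: eq_tens => l ln; rewrite /farg (extzE _ _ (Ordinal ln)) ffunE -qx.
rewrite [RHS]munit_sum pair_bigA Fmap_sum; apply: eq_bigr => ab _.
rewrite Fmap_sum (bigD1 p) // big1 => [|p' p'p].
  rewrite [LHS]addr0 FmapZ (xE ab) (Fmap_homog (homog_fout ab p) (homog_farg ab p)).
  by rewrite /inter interleave_fout eqxx scale1r !scalerA mulrAC ksgnK mul1r.
rewrite FmapZ (xE ab) (Fmap_homog (homog_fout ab p') (homog_farg ab p)).
by rewrite /inter interleave_fout (negPf p'p) scale0r !scaler0.
Qed.

(** A nonzero coefficient forces the degree of E_(a, b) to be that of the arguments plus [q], hence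
    the tensor [fout] to have degree [q]. *)
Lemma mem_Finv q (f : 'Hom(tensor A n, A)) :
  (forall x e, homog n x e -> f (tens n x) \in gpiece A (dsum e n + q)) ->
  Finv f \in tpiece A n.+1 q.
Proof.
move=> fq; apply: memv_suml => ab _; apply: memv_suml => p _.
have [->|nz] := eqVneq (entry ab.1 ab.2 (f (tens n (farg ab p)))) 0.
  by rewrite mulr0 scale0r mem0v.
apply: memvZ; have := tens_tpiece (homog_fout ab p).
rewrite -/(dsum _ _) dsum_fodeg (entry_deg (fq _ _ (homog_farg ab p)) nz).
by rewrite (_ : _ - _ - _ = q) //; ring.
Qed.

(** By [FinvK] the map is onto, and source and target both have dimension (dim A)^(n+1), so its
    kernel is zero. *)
Lemma Fmap_inj : injective (@Fmap k A n).
Proof.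
pose h : 'Hom(tensor A n.+1, 'Hom(tensor A n, A)) := linfun (@Fmap k A n).
have hE t : h t = Fmap t by rewrite lfunE.
have hfull : limg h = fullv.
  apply/eqP; rewrite eqEsubv subvf; apply/subvP => f _.
  by rewrite -(FinvK f) -hE memv_img ?memvf.
have dimE : dim (tensor A n.+1) = dim 'Hom(tensor A n, A).
  change (#|{ffun 'I_n.+1 -> 'I_(gdim A)}| * 1 =
          #|{ffun 'I_n -> 'I_(gdim A)}| * 1 * dim A)%N.
  by rewrite !muln1 !card_ffun !card_ord expnSr; congr (_ * _)%N; exact: dimvf.
have := limg_ker_dim h fullv; rewrite hfull !dimvf dimE -[RHS]add0n => /addIn/eqP.
rewrite capfv dimv_eq0 => /lker0P h_inj s t st.
by apply: h_inj; rewrite !hE.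
Qed.

End FmapInverse.

(** * Differentials of End(V) are inner *)

Lemma central_eq0 p (c : A) : c \in gpiece A p -> p != 0 ->
  (forall j, gmul c (munit j j) = gmul (munit j j) c) -> c = 0.
Proof.
move=> cp p0 cc; apply: entry_inj => i j.
have z : entry i j (0 : A) = 0 by exact: linear0.
rewrite z; apply/eqP/negPn/negP => nz; have ij := entry_deg cp nz.
(* The left (i, j) entry is that of [c]; the right one vanishes, since a nonzero degree excludes i =
   j. *)
have := congr1 (entry i j) (cc j).
rewrite !entry_gmul (bigD1 j) //= [X in _ + X]big1 => [|l lj]; last first.
  by rewrite entry_munit (negPf lj) mulr0.
rewrite entry_munit !eqxx mulr1 addr0 big1 => [/eqP|l _]; first by rewrite (negPf nz).
rewrite entry_munit; case: eqP => [ij'|]; last by rewrite mul0r.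
by move: ij p0; rewrite ij' -[LHS]addr0 => /addrI <-; rewrite eqxx.
Qed.

(** On the E_(j,j), of degree 0, the graded commutator is the ordinary one, so d - d' commutes with
    them while having degree -1. *)
Lemma gcomm_inj (d d' : A) : d \in gpiece A (-1) -> d' \in gpiece A (-1) ->
  (forall x : A, gcomm d x = gcomm d' x) -> d = d'.
Proof.
move=> dd dd' E; apply/eqP; rewrite -subr_eq0; apply/eqP.
apply: (@central_eq0 (-1)) => // [|j]; first exact: memvB.
have j0 : munit j j \in gpiece A 0 by have := munit_deg j j; rewrite subrr.
have := E (munit j j); rewrite (gcommE dd j0) (gcommE dd' j0) mulr0 ksgn0 !scale1r.
rewrite gmulDl gmulDr gmulNl gmulNr => /eqP.
by rewrite subr_eq => /eqP ->; rewrite addrAC [_ - _ - _]addrAC subrr add0r addrC.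
Qed.

Lemma opp_gcomm_homog (d x : A) p : d \in gpiece A (-1) -> x \in gpiece A p ->
  - gcomm d x = ksgn (- p) *: gmul x d - gmul d x.
Proof. by move=> dd xp; rewrite (gcommE dd xp) opprB mulN1r. Qed.

Lemma gmul_munitl i j (x : A) : gmul (munit i j) x = \sum_l entry j l x *: munit i l.
Proof.
apply: entry_inj => a b; rewrite entry_gmul entry_sum (bigD1 j) //= big1 => [|l lj]; last first.
  by rewrite entry_munit (negPf lj) andbF mul0r.
rewrite (bigD1 b) //= big1 => [|l lb]; last first.
  by rewrite entryZ entry_munit [b == l]eq_sym (negPf lb) andbF mulr0.
by rewrite entryZ !entry_munit !eqxx !andbT !addr0 mulrC.
Qed.

Lemma gmul_munitr (x : A) j l : gmul x (munit j l) = \sum_i entry i j x *: munit i l.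
Proof.
apply: entry_inj => a b; rewrite entry_gmul entry_sum (bigD1 j) //= big1 => [|i ij]; last first.
  by rewrite entry_munit (negPf ij) mulr0.
rewrite (bigD1 a) //= big1 => [|i ia]; last first.
  by rewrite entryZ entry_munit [a == i]eq_sym (negPf ia) mulr0.
by rewrite entryZ !entry_munit !eqxx !addr0.
Qed.

Lemma lfun_linearP (W W' : vectType k) (h : 'Hom(W, W')) c u v : h (c *: u + v) = c *: h u + h v.
Proof. exact: linearP. Qed.

Lemma lfun_linearZ (W W' : vectType k) (h : 'Hom(W, W')) c u : h (c *: u) = c *: h u.
Proof. exact: linearZ. Qed.

Lemma lfun_sum (W W' : vectType k) (h : 'Hom(W, W')) (J : finType) (F : J -> W) :
  h (\sum_j F j) = \sum_j h (F j).
Proof. exact: linear_sum. Qed.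

Lemma gcomm_differential (d : A) (m1 : 'End(A)) : d \in gpiece A (-1) -> gmul d d = 0 ->
  (forall x : A, m1 x = - gcomm d x) -> is_differential m1.
Proof.
move=> dd d2 m1E.
have m1h p x : x \in gpiece A p -> m1 x = ksgn (- p) *: gmul x d - gmul d x.
  by move=> xp; rewrite m1E (opp_gcomm_homog dd xp).
have deg p x : x \in gpiece A p -> m1 x \in gpiece A (p - 1).
  move=> xp; rewrite (m1h _ _ xp); apply: memvB; first exact/memvZ/gmul_deg.
  by rewrite addrC; apply: gmul_deg.
split=> // [x|p x y xp].
  elim/munit_ind: x => [|c u v Pu Pv|i j]; first by rewrite !linear0.
    by rewrite !lfun_linearP Pu Pv scaler0 addr0.
  have xp := munit_deg i j; rewrite (m1h _ _ (deg _ _ xp)) (m1h _ _ xp).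
  rewrite !(gmulDl, gmulDr, gmulNl, gmulNr, gmulZl, gmulZr) !gmulA d2 gmul0x.
  rewrite -!gmulA d2 gmulx0 scaler0 add0r subr0 scalerN -opprD -scalerDl.
  (* The two terms d x d cancel, as [m1] has changed the parity of the degree between them. *)
  set p := hdeg i - hdeg j; rewrite (@ksgn_odd _ 0 (- (p - 1)) (- p)); last by ring.
  by rewrite addNr scale0r oppr0.
elim/munit_ind: y => [|c u v Pu Pv|i j].
- by rewrite gmulx0 (linear0 m1) !gmulx0 scaler0 addr0.
- rewrite gmulP2r !lfun_linearP gmulP2r Pu Pv gmulP2r !scalerDr !scalerA.
  by rewrite [c * _]mulrC addrACA.
have yq := munit_deg i j; rewrite (m1h _ _ (gmul_deg xp yq)) (m1h _ _ xp) (m1h _ _ yq).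
rewrite !(gmulDl, gmulDr, gmulNl, gmulNr, gmulZl, gmulZr) !gmulA opprD ksgnD.
by rewrite scalerBr scalerA [RHS]addrC addrA subrK.
Qed.

(** For homogeneous x, the sum over l of m(x E_(l,0)) E_(0,l) is d0 x when x E_(l,0) is expanded in
    matrix units, and m(x) plus the signed x d0 by the Leibniz rule. Hence m is the commutator with
    d0, and d = - d0. *)
Lemma differential_inner (m1 : 'End(A)) : is_differential m1 ->
  exists d : A, [/\ d \in gpiece A (-1), gmul d d = 0 &
    forall x : A, m1 x = - gcomm d x].
Proof.
case=> deg sq leib.
(* Without an index V is zero, so End(V) is zero too and d = 0 serves. *)
have [i0 _|none] := pickP (fun _ : I => true); last first.
  exists 0; split=> [||x]; first exact: mem0v.
    exact: gmul0x.
  by apply: entry_inj => i; have := none i.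
pose d0 : A := \sum_j gmul (m1 (munit j i0)) (munit i0 j).
have d0d : d0 \in gpiece A (-1).
  apply: memv_suml => j _.
  have := gmul_deg (deg _ _ (munit_deg j i0)) (munit_deg i0 j).
  by rewrite (_ : _ - 1 + _ = -1) //; ring.
have m1h p x : x \in gpiece A p -> gmul d0 x = m1 x + ksgn (- p) *: gmul x d0.
  move=> xp; have suml (z : A) F : gmul (\sum_(j : I) F j) z = \sum_j gmul (F j) z.
    by apply: (big_morph (fun w => gmul w z)) => [u v|]; [exact: gmulDl | exact: gmul0x].
  have sumr (z : A) F : gmul z (\sum_(j : I) F j) = \sum_j gmul z (F j).
    by apply: (big_morph (gmul z)) => [u v|]; [exact: gmulDr | exact: gmulx0].
  have -> : m1 x + ksgn (- p) *: gmul x d0 =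
      \sum_l gmul (m1 (gmul x (munit l i0))) (munit i0 l).
    under [RHS]eq_bigr do rewrite (leib _ _ _ xp) gmulDl gmulZl -!gmulA munit_gmul eqxx scale1r.
    rewrite big_split /= -scaler_sumr -!sumr; congr (_ + _).
    rewrite -[LHS](@gmulx1 k A); apply: (congr1 (gmul (m1 x))); apply: entry_inj => a b.
    rewrite entry_sum (bigD1 a) //= big1 => [|l la].
      by rewrite entry_munit eqxx addr0 /entry id_lfunE coord_hbasisE.
    by rewrite entry_munit [a == l]eq_sym (negPf la).
  rewrite suml; under eq_bigr do rewrite -gmulA gmul_munitl sumr.
  rewrite exchange_big; apply: eq_bigr => l _.
  rewrite (gmul_munitr x) lfun_sum suml; apply: eq_bigr => j _.
  by rewrite lfun_linearZ gmulZl gmulZr.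
have m1E x : m1 x = - gcomm (- d0) x.
  have nd : - d0 \in gpiece A (-1) by rewrite memvN.
  elim/munit_ind: x => [|c u v Pu Pv|i j].
  - have := gcomm_is_linear (- d0) (-1) 0 0.
    by rewrite !scaleN1r !addNr linear0 => ->; rewrite oppr0.
  - by rewrite gcomm_is_linear lfun_linearP Pu Pv scalerN opprD.
  have xp := munit_deg i j; rewrite (opp_gcomm_homog nd xp) gmulNl gmulNr opprK.
  by rewrite (m1h _ _ xp) scalerN addrCA addNr addr0.
exists (- d0); split=> //; first by rewrite memvN.
rewrite gmulNl gmulNr opprK; apply: (@central_eq0 (-1 - 1)) => // [|j].
  exact: gmul_deg.
have j0 : munit j j \in gpiece A 0 by have := munit_deg j j; rewrite subrr.
have E1 := m1h _ _ j0; rewrite oppr0 ksgn0 scale1r in E1.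
have y : m1 (munit j j) = gmul d0 (munit j j) - gmul (munit j j) d0 by rewrite E1 addrK.
(* Since m squares to zero, d0 anticommutes with m(E_(j,j)), the commutator of d0 and E_(j,j). The
   terms d0 E_(j,j) d0 cancel, and the square of d0 commutes with E_(j,j). *)
have := m1h _ _ (deg _ _ j0); rewrite sq add0r sub0r opprK ksgn1 scaleN1r y.
by rewrite !(gmulDl, gmulDr, gmulNl, gmulNr) opprB !gmulA => /addIr.
Qed.

End EndMatrixUnits.

(** * Assembling the bijection *)

Local Open Scope classical_set_scope.

Theorem theorem4p6 (k : fieldType) (char0 : [pchar k] =i pred0)
    (V : gradedVect k) :
  set_bij
    [set rs : tenfam (endAlg V) * tenfam (endAlg V) | infYB_pair rs.1 rs.2]
    [set mRS : 'End(endAlg V) * opfam (endAlg V) * opfam (endAlg V) |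
       is_differential mRS.1.1 /\ hcRB_operator mRS.1.1 mRS.1.2 mRS.2]
    (@chi k (endAlg V)).
Proof.
set A := endAlg V.
have graded r : fam_deg r -> graded_ops (FmapS r : opfam A).
  move=> rd n x e xh; have := mem_Fmap xh (rd n.+1).
  by rewrite (_ : n.+2%:Z - 2 = n.+1%:Z - 1) //; lia.
split.
- move=> [r s] H; have {H} [rd sd rs0 d2 YB] : infYB_pair r s by exact: H.
  have m1E := chi1E (r, s).
  have m1diff := gcomm_differential (mem_untens (rd 0%N)) d2 m1E.
  split=> //; split=> [||n n_gt0]; [exact: graded..|].
  have [YBr YBs] := YB n n_gt0.
  split; first exact/(RB_eq_Fmap rd rd sd n_gt0 m1E (@Fmap_inj _ _ _)).
  exact/(RB_eq_Fmap sd rd sd n_gt0 m1E (@Fmap_inj _ _ _)).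
- move=> [r s] [r' s'] /set_mem H /set_mem H' E.
  have {H} [rd sd rs0 _ _] : infYB_pair r s by exact: H.
  have {H'} [rd' sd' rs0' _ _] : infYB_pair r' s' by exact: H'.
  (* [chi] records d only through its commutator, which determines d because its degree is nonzero;
     F without arguments then returns from d to the tensor. *)
  have E0 : r 0%N = r' 0%N.
    have dE : untens (r 0%N) = untens (r' 0%N).
      apply: gcomm_inj; [exact: mem_untens (rd 0%N)|exact: mem_untens (rd' 0%N)|].
      move=> x; apply: oppr_inj.
      by rewrite -(chi1E (r, s)) -(chi1E (r', s')) E.
    apply: Fmap_inj; apply: lfun_tensP => x _ _.
    by rewrite (Fmap_tens0 x (rd 0%N)) (Fmap_tens0 x (rd' 0%N)).
  have ER : FmapS r = FmapS r' by exact: (f_equal (fun z => z.1.2) E).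
  have ES : FmapS s = FmapS s' by exact: (f_equal snd E).
  (* At index 0 the second family is recovered from r_1 = s_1; at positive indices F is
     injective. *)
  congr (_, _); apply: functional_extensionality_dep => -[|n] //; apply: Fmap_inj.
  + exact: (f_equal (fun R : opfam A => R n) ER).
  + by rewrite -rs0 -rs0' E0.
  + exact: (f_equal (fun R : opfam A => R n) ES).
move=> [[m1 R] S] H.
have {H} [m1diff [Rd Sd RB]] : is_differential m1 /\ hcRB_operator m1 R S by exact: H.
have [d [dd d2 m1E]] := differential_inner m1diff.
(* Both lifted families start with the same d, which gives r_1 = s_1; the tensor with n+2 factors
   comes from the operator with n+1 arguments. *)
pose lift (T : opfam A) : tenfam A :=
  fun n => if n is m.+1 then Finv (T m) else tens 1 (fun=> d).
have d_untens T : untens (lift T 0%N) = d.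
  by apply: (untens_tens (da := fun=> -1)) => l _.
have lift_deg T : graded_ops T -> fam_deg (lift T).
  move=> Td [|n]; last first.
    rewrite (_ : n.+2%:Z - 2 = n.+1%:Z - 1); last by lia.
    exact/mem_Finv/Td.
  have dh : homog 1 (fun=> d) (fun=> -1) by [].
  by have := tens_tpiece dh; rewrite big_ord1.
have liftK T : FmapS (lift T) = T.
  by apply: functional_extensionality_dep => n; apply: FinvK.
have rd := lift_deg R Rd; have sd := lift_deg S Sd.
have m1E' x : m1 x = - gcomm (untens (lift R 0%N)) x by rewrite d_untens m1E.
exists (lift R, lift S) => /=.
  split=> //=; first by rewrite d_untens.
  move=> n n_gt0; have [RBr RBs] := RB n n_gt0.
  split.
    apply/(RB_eq_Fmap rd rd sd n_gt0 m1E' (@Fmap_inj _ _ _)).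
    by rewrite !liftK.
  apply/(RB_eq_Fmap sd rd sd n_gt0 m1E' (@Fmap_inj _ _ _)).
  by rewrite !liftK.
congr (_, _, _); [|exact: liftK..].
by apply/lfunP => x; rewrite (chi1E (lift R, lift S)) m1E'.
Qed.
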